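(* Let $p>2$, $\beta=1/(p-1)$, $R,T>0$, and let $u\in C^{2,1}(Q_{R,T})$ be a classical solution of $u_t-\Delta u=|\nabla u|^p$ in $Q_{R,T}:=B_R\times(0,T)$. (i) For each $a\in[0,1)$ there exists $C=C(n,p,a)>0$ (independent of $u,R,T$) such that $$a|\nabla u|^p-u_t\le C\big(R^{-\beta-1}+R^{1-\beta}t^{-1}\big)\quad\text{in } B_{R/2}\times(0,T).$$ (ii) There exists $C=C(n,p)>0$ such that for all $0<t<s<T$ and all $x,y\in B_{R/2}$, $$u(x,t)\le u(y,s)+C\Big(\frac{|y-x|^p}{s-t}\Big)^{\beta}+C\big(R^{-\beta-1}+R^{1-\beta}t^{-1}\big)(s-t).$$
   Context: $B_R:=\{x\in\mathbb{R}^n: |x|<R\}$. *)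

(* Defs.v *)
From HB Require Import structures.
From mathcomp Require Import all_boot all_order all_algebra.
From mathcomp Require Import all_classical all_reals all_analysis.
Set Implicit Arguments. Unset Strict Implicit. Unset Printing Implicit Defensive.
Import Order.TTheory GRing.Theory Num.Theory.
Import numFieldNormedType.Exports.
Local Open Scope ring_scope.

Definition enorm (R : realType) (n : nat) (x : 'rV[R]_n) : R :=
  Num.sqrt (\sum_(i < n) (x ord0 i) ^+ 2).

Definition ebasis (R : realType) (n : nat) (i : 'I_n) : 'rV[R]_n := delta_mx ord0 i.

Definition dx (R : realType) (n : nat) (u : 'rV[R]_n -> R -> R) (i : 'I_n)
  (x : 'rV[R]_n) (t : R) : R := 'D_(ebasis R i) (fun y => u y t) x.

Definition dxx (R : realType) (n : nat) (u : 'rV[R]_n -> R -> R) (i j : 'I_n)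
  (x : 'rV[R]_n) (t : R) : R := 'D_(ebasis R j) (fun y => dx u i y t) x.

Definition dt (R : realType) (n : nat) (u : 'rV[R]_n -> R -> R)
  (x : 'rV[R]_n) (t : R) : R := 'D_1 (fun s => u x s) t.

Definition grad (R : realType) (n : nat) (u : 'rV[R]_n -> R -> R)
  (x : 'rV[R]_n) (t : R) : 'rV[R]_n := \row_(i < n) dx u i x t.

Definition lap (R : realType) (n : nat) (u : 'rV[R]_n -> R -> R)
  (x : 'rV[R]_n) (t : R) : R := \sum_(i < n) dxx u i i x t.

Definition inQ (R : realType) (n : nat) (r T : R) (x : 'rV[R]_n) (t : R) : Prop :=
  enorm x < r /\ 0 < t < T.

Definition C21 (R : realType) (n : nat) (r T : R) (u : 'rV[R]_n -> R -> R) : Prop :=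
  forall x t, inQ r T x t ->
    [/\ (forall i : 'I_n, derivable (fun y => u y t) x (ebasis R i))
        /\ (forall i j : 'I_n, derivable (fun y => dx u i y t) x (ebasis R j))
        /\ derivable (fun s => u x s) t 1,
        {for (x, t), continuous (fun z : 'rV[R]_n * R => u z.1 z.2)},
        forall i : 'I_n, {for (x, t), continuous (fun z : 'rV[R]_n * R => dx u i z.1 z.2)},
        forall i j : 'I_n, {for (x, t), continuous (fun z : 'rV[R]_n * R => dxx u i j z.1 z.2)}
      & {for (x, t), continuous (fun z : 'rV[R]_n * R => dt u z.1 z.2)}].

Definition classical_solution (R : realType) (n : nat) (p r T : R)
  (u : 'rV[R]_n -> R -> R) : Prop :=
  C21 r T u /\
  forall x t, inQ r T x t -> dt u x t - lap u x t = powR (enorm (grad u x t)) p.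

(* Main.v *)
Require Import Defs.
From HB Require Import structures.
From mathcomp Require Import all_boot all_order all_algebra.
From mathcomp Require Import all_classical all_reals all_analysis.
From mathcomp Require Import ring lra.
Import Order.TTheory GRing.Theory Num.Theory.
Import numFieldNormedType.Exports.
Local Open Scope ring_scope.

(** By scaling take R = 1.  Part (i) is a Bernstein argument for
    w = a (1 + |grad u|^2)^(p/2) - u_t.  Formally, with L the linearised operator
    d/dt - Laplacian - p |grad u|^(p-2) grad u . grad, one has L u_t = 0 and
    L f(|grad u|^2) <= - 2 f' |D^2 u|^2 for f convex, while
    - (Laplacian u) >= w + c |grad u|^p - C by the equation and a < 1.  Hence
    L w <= - c (1 + |grad u|^(p-2)) (w^2 + |grad u|^(2p)) once w is large, and
    this absorbs every term produced by L on the barrier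
    k (9/16 - |x|^2)^(-2) (t - t0)^(-1) at a point where that barrier touches w
    from above; so k is bounded in terms of n, p, a and t - t0 only.
    As u is merely C^{2,1}, w has no derivatives.  The argument is run on w_h, in
    which each u_i is replaced by a forward quotient (u(x + h e_i) - u(x))/h and
    u_t by a backward quotient (u(t) - u(t - h))/h: these are C^{2,1} and satisfy
    linear equations whose drifts come from the mean value theorem for |q|^p.  The
    gradient of the time quotient, which is not bounded as h -> 0, is eliminated
    through the first order condition at the touching point.
    Part (ii) integrates (i) with a = 1/2 along the space-time segment from (x,t)
    to (y,s) and uses Young's inequality. *)

(** * One-variable calculus *)

(** The order of the quantifiers makes the constants independent of u. The number m of
    [touching_contradiction] is fixed from n, p, a alone; then u and a closed cylinder inside Q are
    given, and only then is h made small, in terms of the moduli of continuity of the derivatives of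
    u there. These moduli enter through errors forced below 1 or 1/2, so nothing of u survives in
    the bound, and h -> 0 is taken at one fixed point. Discretising has a price: each space quotient
    has its own drift B_i and the time quotient another drift b. All are close to p |grad u|^(p-2)
    grad u, and half of the good term |D^2 u|^2 pays for the mismatch. The 1 in 1 + |grad u|^2 keeps
    the base positive, since P = p/2 may lie below 2 and z^P is then not twice differentiable at 0.
    The power -2 in the barrier is dictated by the drift term |grad u|^(p-1) psi y with y = (9/16 -
    |x|^2)^(-1): it is absorbed when y^2 is at most a small multiple of psi. *)

Section calculus.
Set Implicit Arguments. Unset Strict Implicit. Unset Printing Implicit Defensive.
Local Open Scope classical_set_scope.
Local Open Scope ring_scope.
Context {R : realType}.
Implicit Types (f g : R -> R) (x a b : R).

Lemma is_derive1D f g x a b : is_derive x 1 f a -> is_derive x 1 g b ->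
  is_derive x 1 (fun y => f y + g y) (a + b).
Proof. by move=> *; exact: is_deriveD. Qed.

Lemma is_derive1B f g x a b : is_derive x 1 f a -> is_derive x 1 g b ->
  is_derive x 1 (fun y => f y - g y) (a - b).
Proof. by move=> *; exact: is_deriveB. Qed.

Lemma is_derive1M f g x a b : is_derive x 1 f a -> is_derive x 1 g b ->
  is_derive x 1 (fun y => f y * g y) (a * g x + f x * b).
Proof.
move=> fa gb; have fgab := @is_deriveM R R f g x 1 a b fa gb.
apply: (is_derive_eq fgab).
by rewrite /GRing.scale/= addrC [g x * a]mulrC.
Qed.

Lemma is_derive1Z c f x a : is_derive x 1 f a ->
  is_derive x 1 (fun y => c * f y) (c * a).
Proof.
move=> fa.
have D := @is_derive1M (fun=> c) f x 0 a (is_derive_cst c x 1) fa.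
apply: (is_derive_eq D).
by rewrite mul0r add0r.
Qed.

Lemma is_derive1X2 f x a : is_derive x 1 f a ->
  is_derive x 1 (fun y => f y ^+ 2) (2 * f x * a).
Proof.
by move=> fa; apply: (is_derive_eq (@is_derive1M f f x a a fa fa)); ring.
Qed.

Lemma is_derive1_sum n (f : 'I_n -> R -> R) x (a : 'I_n -> R) :
  (forall i, is_derive x 1 (f i) (a i)) ->
  is_derive x 1 (fun y => \sum_(i < n) f i y) (\sum_(i < n) a i).
Proof.
move=> fa; have -> : (fun y => \sum_(i < n) f i y) = \sum_(i < n) f i.
  by apply/funext => y; rewrite fct_sumE.
exact: is_derive_sum.
Qed.

Lemma is_derive1_compose f g x a b : is_derive (g x) 1 f a ->
  is_derive x 1 g b -> is_derive x 1 (fun y => f (g y)) (a * b).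
Proof. by move=> fa gb; exact: (is_derive1_comp fa gb). Qed.

Lemma is_derive1_lin a b x : is_derive x 1 (fun y => a + y * b) b.
Proof.
have D := @is_derive1D (fun=> a) (fun y => y * b) x 0 _ (is_derive_cst a x 1)
  (@is_derive1M id (fun=> b) x 1 0 (is_derive_id x 1) (is_derive_cst b x 1)).
by apply: (is_derive_eq D) => /=; ring.
Qed.

Lemma is_derive1_continuous f x a : is_derive x 1 f a -> {for x, continuous f}.
Proof.
by move=> fa; apply: differentiable_continuous; apply/derivable1_diffP; case: fa.
Qed.

Lemma mean_value f df a b : a < b ->
  (forall x, a <= x <= b -> is_derive x 1 f (df x)) ->
  exists2 c, a < c < b & f b - f a = df c * (b - a).
Proof.
move=> ab fdf.
have [||c cab ->] := @MVT R f df a b ab.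
- by move=> x /[!in_itv]/= /andP[ax xb]; apply: fdf; rewrite !ltW.
- apply: derivable_within_continuous => x /[!in_itv]/= xab.
  by have [] := fdf x xab.
by exists c => //; move: cab; rewrite in_itv.
Qed.

(** Only points to the left are compared, because the touching point may lie on the top face of the
    closed cylinder. *)
Lemma near_left_ge0 f x d : is_derive x 1 f d ->
  (\forall y \near x^'-, f y <= f x) -> 0 <= d.
Proof.
move=> fd fle; rewrite leNgt; apply/negP => d0.
have [df dE] := fd.
have cv : h^-1 *: (f (h *: 1 + x) - f x) @[h --> 0^'] --> d.
  by rewrite -dE; exact: df.
have {cv} : \forall h \near (0:R)^', h^-1 *: (f (h *: 1 + x) - f x) < 0.
  by apply: (cvgr_lt d cv).
rewrite /dnbhs near_withinE => /nbhs_ballP[e1 /= e10 H1].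
move: fle; rewrite near_withinE => /nbhs_ballP[e2 /= e20 H2].
pose h := - (Num.min e1 e2 / 2).
have m0 : 0 < Num.min e1 e2 by rewrite lt_min e10.
have h0 : h < 0 by rewrite /h; lra.
have hm : `|h| < Num.min e1 e2 by rewrite /h normrN gtr0_norm; lra.
have := H1 h; rewrite /ball/= sub0r normrN.
move/(_ (lt_le_trans hm _)); rewrite ge_min lexx => /(_ isT).
rewrite lt_eqF// => /(_ isT).
have := H2 (h *: 1 + x); rewrite /ball/= opprD addrCA subrr addr0 normrN.
rewrite /GRing.scale/= mulr1 => /(_ (lt_le_trans hm _)).
rewrite ge_min lexx orbT => /(_ isT) /(_ _) F.
have {}F : f (h + x) <= f x by apply: F; lra.
rewrite nmulr_rlt0 ?invr_lt0//; lra.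
Qed.

(** [f'] is differentiable at x alone. If [f''] were positive, [f'] would be positive just to the
    right of x, and the mean value theorem would give a larger value of f there. *)
Lemma local_max_deriv f (f' : R -> R) (f'' x : R) :
  (\forall y \near x, is_derive (y : R) 1 f (f' y)) -> is_derive x 1 f' f'' ->
  (\forall y \near x, f y <= f x) -> f' x = 0 /\ f'' <= 0.
Proof.
move=> Df Df' fle.
have [e e0 H] : exists2 e : R, 0 < e & forall y, `|y - x| <= e ->
    is_derive y 1 f (f' y) /\ f y <= f x.
  move: Df => /nbhs_ballP[e1 /= e10 H1]; move: fle => /nbhs_ballP[e2 /= e20 H2].
  have m0 : 0 < Num.min e1 e2 by rewrite lt_min e10.
  exists (Num.min e1 e2 / 2) => [|y yx]; first by lra.
  have : `|x - y| < Num.min e1 e2 by rewrite distrC; lra.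
  by rewrite lt_min => /andP[? ?]; split; [exact: H1|exact: H2].
have f'x : f' x = 0.
  have := @derive1_at_max R f (x - e) (x + e) x.
  case.
  - by lra.
  - move=> t; rewrite in_itv/= => tx; case: (H t _) => [|[]//].
    by rewrite ler_norml; lra.
  - by rewrite in_itv/=; lra.
  - move=> t; rewrite in_itv/= => tx; case: (H t _) => //.
    by rewrite ler_norml; lra.
  move=> _ D0; case: (H x _) => [|[_ <-] _]; last by [].
  by rewrite subrr normr0; lra.
split=> //; rewrite leNgt; apply/negP => f''0.
have [df dE] := Df'.
have cv : h^-1 *: (f' (h *: 1 + x) - f' x) @[h --> 0^'] --> f''.
  by rewrite -dE; exact: df.
have {cv} : \forall h \near (0:R)^', 0 < h^-1 *: (f' (h *: 1 + x) - f' x).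
  by apply: (cvgr_gt f'' cv).
rewrite /dnbhs near_withinE => /nbhs_ballP[e1 /= e10 H1].
pose h := Num.min e e1 / 2.
have m0 : 0 < Num.min e e1 by rewrite lt_min e0.
have h0 : 0 < h by rewrite /h; lra.
have he : h <= e by apply: (@le_trans _ _ (Num.min e e1)); [rewrite /h; lra|rewrite ge_min lexx].
have he1 : h < e1.
  by apply: (@lt_le_trans _ _ (Num.min e e1)); [rewrite /h; lra|rewrite ge_min lexx orbT].
have [||c cx E] := @mean_value f f' x (x + h).
- by lra.
- by move=> y yx; case: (H y _) => //; rewrite ler_norml; lra.
have : 0 < f' c.
  have := H1 (c - x); rewrite /ball/= sub0r normrN ltr_norml.
  have -> : - e1 < c - x < e1 by lra.
  have cx0 : 0 < c - x by lra.
  rewrite gt_eqF// => /(_ isT isT).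
  by rewrite f'x subr0 /GRing.scale/= mulr1 subrK pmulr_rgt0 ?invr_gt0.
have [|_ ] := H (x + h); first by rewrite addrC addKr gtr0_norm.
move=> fh fc; have : 0 < f' c * h by rewrite mulr_gt0.
by move: E; rewrite [x + h - x]addrC addKr; lra.
Qed.

Lemma is_derive_line n (g : 'rV[R]_n -> R) y v s : derivable g (y + s *: v) v ->
  is_derive s 1 (fun t => g (y + t *: v)) ('D_v g (y + s *: v)).
Proof.
move=> dg.
have E : (fun h : R => h^-1 *: (((fun t => g (y + t *: v)) \o shift s) (h *: 1)
            - g (y + s *: v)))
         = (fun h => h^-1 *: ((g \o shift (y + s *: v)) (h *: v) - g (y + s *: v))).
  apply/funext => h /=.
  by rewrite [h *: 1]mulr1 scalerDl addrCA.
by apply: DeriveDef; [rewrite /derivable E|rewrite /derive E].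
Qed.

End calculus.

(** * Powers and numerical inequalities *)

Section powers.
Set Implicit Arguments. Unset Strict Implicit. Unset Printing Implicit Defensive.
Local Open Scope classical_set_scope.
Local Open Scope ring_scope.
Context {R : realType}.

(** [powR] of a negative base is a default value; the absolute value makes the power continuous on
    the whole line, 0 included. *)
Lemma powR_norm_continuous (r : R) : 0 < r ->
  continuous (fun x : R => powR `|x| r).
Proof.
move=> r0 x; have [->|x0] := eqVneq x 0.
  apply/cvgrPdist_lt => e e0; apply/nbhs_ballP.
  exists (powR e r^-1) => [|y]; first by rewrite /= powR_gt0.
  rewrite /ball/= sub0r normrN => ye.
  rewrite normr0 powR0 ?gt_eqF// sub0r normrN ger0_norm ?powR_ge0//.
  have -> : e = powR (powR e r^-1) r.
    by rewrite -powRrM mulVf ?gt_eqF// powRr1// ltW.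
  by apply: gt0_ltr_powR => //; rewrite nnegrE ?powR_ge0.
apply: (@continuous_comp _ _ _ (fun z : R => `|z|) (fun z => powR z r)).
  exact: norm_continuous.
apply: is_derive1_continuous.
by apply: is_derive1_powR; rewrite normr_gt0.
Qed.

(** Mean value theorem for z^P on the closed half-line. Since 0 may be an endpoint, the derivative
    is used inside the interval only and continuity at its ends. *)
Lemma powR_slope (P s s' : R) : 1 < P -> 0 <= s -> 0 <= s' ->
  exists c, [/\ Num.min s s' <= c, c <= Num.max s s' &
    powR s' P - powR s P = P * powR c (P - 1) * (s' - s)].
Proof.
move=> P1; wlog ss : s s' / s <= s' => [H s0 s'0|s0 s'0].
  have [ss|ss] := leP s s'; first by have := H s s' ss s0 s'0; rewrite min_l// max_r.
  have [c [c1 c2 E]] := H s' s (ltW ss) s'0 s0.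
  move: c1 c2; rewrite min_l ?max_r ?(ltW ss)// => c1 c2.
  by exists c; split=> //; rewrite -opprB E -mulrN opprB.
rewrite min_l// max_r//; move: ss; rewrite le_eqVlt => /predU1P[->|ss].
  by exists s'; rewrite !lexx; split=> //; rewrite !subrr mulr0.
have [||c cab ->] := @MVT R (fun x => powR x P) (fun x => P * powR x (P - 1)) s s' ss.
- move=> x /[!in_itv]/= /andP[sx xs].
  by apply: is_derive1_powR; apply: le_lt_trans sx.
- apply: (@subspace_eq_continuous _ _ _ (fun x : R => powR `|x| P)).
    move=> x; rewrite inE/= in_itv/= => /andP[sx _].
    by rewrite /= ger0_norm//; apply: le_trans sx.
  by apply: continuous_subspaceT; apply: powR_norm_continuous; lra.
by move: cab; rewrite in_itv/= => /andP[/ltW ? /ltW ?]; exists c; split.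
Qed.

(** Continuity is that of f on the whole space, at the points of K; so y may leave K, as the shifted
    points of a difference quotient do. *)
Lemma compact_uniformly_continuous (X : pseudoMetricType R) (K : set X)
    (f : X -> R) e : compact K -> (forall x, K x -> {for x, continuous f}) ->
  0 < e -> \forall d \near (0 : R)^'+,
    forall x, K x -> forall y, ball x d y -> `|f y - f x| < e.
Proof.
move=> /compact_near_coveringP cK cf e0.
apply: (cK R (0 : R)^'+ (fun d x => forall y, ball x d y -> `|f y - f x| < e)).
move=> x Kx; have /cvgrPdist_lt := cf x Kx => /(_ (e / 2)).
rewrite divr_gt0// => /(_ isT) /nbhs_ballP[d /= d0 H].
exists (ball x (d / 2), [set r | r < d / 2]) => /=.
  split; first by apply: nbhsx_ballx; rewrite divr_gt0.
  by apply: nbhs_right_lt; rewrite divr_gt0.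
move=> [z r] [/= xz rd] y zy.
have xy : ball x d y by apply: ball_split xz (le_ball (ltW rd) zy).
have xz' : ball x d z by apply: le_ball xz; lra.
have := H _ xy; have := H _ xz' => /= A B.
have -> : f y - f z = (f x - f z) - (f x - f y) by ring.
by apply: (le_lt_trans (ler_normB _ _)); lra.
Qed.

Lemma sqr_sum_le n (a : 'I_n -> R) :
  (\sum_(i < n) a i) ^+ 2 <= n%:R * \sum_(i < n) a i ^+ 2.
Proof.
elim: n a => [|n IH] a; first by rewrite !big_ord0 mul0r expr0n.
rewrite !big_ord_recr/=; move: (IH (fun i => a (widen_ord (leqnSn n) i))).
have : n = 0%N -> \sum_(i < n) a (widen_ord (leqnSn n) i) = 0.
  by move=> n0; rewrite big1// => i; case: (cast_ord n0 i).
have : 0 <= \sum_(i < n) a (widen_ord (leqnSn n) i) ^+ 2.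
  by apply: sumr_ge0 => i _; rewrite sqr_ge0.
set A := \sum_(_ < n) a _; set Q := \sum_(_ < n) _; move: (a _) A Q => b A Q.
rewrite -natr1 => Q0 A0 H.
(* Multiplied by n, this is (A - n b)^2 >= 0 combined with A^2 <= n Q; the case n = 0 is separate
   because n is then cancelled. *)
have : 2 * A * b <= Q + n%:R * b ^+ 2; last by nra.
have [/A0 ->|n_gt0] := posnP n; first by rewrite mulr0 mul0r addr_ge0// mulr_ge0// sqr_ge0.
have n1 : 0 < n%:R :> R by rewrite ltr0n.
by rewrite -(ler_pM2l n1); have := sqr_ge0 (A - n%:R * b); nra.
Qed.

(** For large s the ratio of (3/2 + s)^P to s^P is close to 1, which a < 1 beats; bounded s is left
    to C. Here 3/2 is 1 plus the error 1/2 allowed between the square sums of the space quotients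
    and of the gradient. *)
Lemma power_gap (a P : R) : 2^-1 <= a -> a < 1 -> 1 <= P -> exists c C : R,
  [/\ 0 < c, 0 <= C & forall s, 0 <= s ->
    c * powR (1 + s) P - C <= powR s P - a * powR (3 / 2 + s) P].
Proof.
move=> a2 a1 P1.
have P0 : 0 < P by lra.
(* The product a b is the midpoint (1 + a)/2 of a and 1, and 3/2 + s <= l s as soon as s >= s0. *)
pose b := (1 + a) / (2 * a).
have a0 : 0 < a by lra.
have b1 : 1 < b by rewrite /b ltr_pdivlMr; lra.
pose l := powR b P^-1.
have l0 : 0 < l by rewrite powR_gt0; lra.
have lP : powR l P = b by rewrite /l -powRrM mulVf ?gt_eqF// powRr1//; lra.
have l1 : 1 < l.
  rewrite ltNge; apply/negP => l1.
  have : powR l P <= powR 1 P.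
    by apply: ge0_ler_powR; rewrite ?nnegrE //; lra.
  by rewrite lP powR1; lra.
pose s0 := Num.max 1 (3 / 2 / (l - 1)).
(* As 1 + s <= 2 s for s >= 1, the term c (1 + s)^P costs at most (1 - a)/2 of s^P, which is what a
   b = (1 + a)/2 leaves. *)
pose c := (1 - a) / 2 / powR 2 P.
have p2 : 0 < powR 2 P by rewrite powR_gt0.
have c0 : 0 < c by rewrite /c !divr_gt0//; lra.
have s01 : 1 <= s0 by rewrite le_max lexx.
exists c, (c * powR (1 + s0) P + a * powR (3 / 2 + s0) P); split=> //.
  by rewrite addr_ge0// mulr_ge0 ?powR_ge0// ltW.
move=> s s_ge0; have mono x y : 0 <= x -> x <= y -> powR x P <= powR y P.
  by move=> x0 xy; apply: ge0_ler_powR; rewrite ?nnegrE //; lra.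
have [ss0|ss0] := leP s s0.
  have A := mono (1 + s) (1 + s0); have B := mono (3 / 2 + s) (3 / 2 + s0).
  have {}A : powR (1 + s) P <= powR (1 + s0) P by apply: A; lra.
  have {}B : powR (3 / 2 + s) P <= powR (3 / 2 + s0) P by apply: B; lra.
  have := powR_ge0 s P; nra.
have s1 : 1 <= s by lra.
have A : powR (1 + s) P <= powR 2 P * powR s P.
  by rewrite -powRM//; apply: mono; lra.
have B : powR (3 / 2 + s) P <= b * powR s P.
  rewrite -lP -powRM//; last by lra.
  apply: mono; first by lra.
  have : 3 / 2 / (l - 1) <= s.
    by apply: le_trans (ltW ss0); rewrite le_max lexx orbT.
  by rewrite ler_pdivrMr; lra.
have E1 : c * powR (1 + s) P <= (1 - a) / 2 * powR s P.
  have -> : (1 - a) / 2 * powR s P = c * (powR 2 P * powR s P).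
    by rewrite /c; field; rewrite gt_eqF.
  by rewrite ler_pM2l.
have E2 : a * powR (3 / 2 + s) P <= (1 + a) / 2 * powR s P.
  have -> : (1 + a) / 2 * powR s P = a * (b * powR s P).
    by rewrite /b; field; rewrite gt_eqF.
  by rewrite ler_pM2l.
have := mulr_ge0 (ltW c0) (powR_ge0 (1 + s0) P).
have := mulr_ge0 (ltW a0) (powR_ge0 (3 / 2 + s0) P).
lra.
Qed.

(* X plays the Laplacian of u, A = (1 + |grad u|^2)^(P-1), B = (1 + |grad u|^2)^P and
   g = (1 + |grad u|^2)^(1/2); the left-hand side collects the time derivative, the
   Laplacian and the drift of the barrier psi. *)
Lemma barrier_absorption (c1 c2 C C0 N : R) :
    0 < c1 -> 0 < c2 -> 0 <= C -> 0 <= C0 -> 0 < N ->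
  exists2 m : R, 1 <= m & forall A B g psi y th X : R,
    1 <= A -> 1 <= g -> g ^+ 2 <= B -> 1 <= y -> 0 <= th ->
    m ^+ 2 * y ^+ 2 <= psi -> m ^+ 2 * th <= psi ->
    psi + c2 * B - C0 <= - X ->
    C * A * (psi * th + psi * y ^+ 2 + g * psi * y)
      < c1 * A * (X ^+ 2 / N - 1).
Proof.
move=> c10 c20 C_0 C00 N0.
(* Squaring psi/2 + c2 B <= -X gives X^2 >= psi^2/4 + c2^2 B^2; k is the smaller coefficient. *)
pose k := Num.min 4^-1 (c2 ^+ 2).
have k0 : 0 < k by rewrite lt_min invr_gt0 ltr0n exprn_gt0.
have k4 : k <= 4^-1 by rewrite ge_min lexx.
have kc : k <= c2 ^+ 2 by rewrite ge_min lexx orbT.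
pose K := c1 * k / N.
have K0 : 0 < K by rewrite divr_gt0// mulr_gt0.
(* One summand per task: 2 C0 hides C0 in psi/2, 6 C / K puts the three barrier terms, each at most
   Z/m, into half of K Z, and 2 c1 / K puts the -1 into the other half. *)
pose m := 1 + 2 * C0 + (6 * C) / K + 2 * c1 / K.
have h1 : 0 <= (6 * C) / K by apply: divr_ge0; lra.
have h2 : 0 <= 2 * c1 / K by apply: divr_ge0; lra.
have m1 : 1 <= m by rewrite /m; lra.
have mC0 : 2 * C0 <= m by rewrite /m; lra.
have mC : 6 * C < K * m.
  have -> : K * m = K * (1 + 2 * C0 + 2 * c1 / K) + 6 * C.
    by rewrite /m; field; rewrite gt_eqF.
  by rewrite ltrDr mulr_gt0//; move: (h1) (h2); set z1 := _ / K; lra.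
have mc : 2 * c1 < K * m.
  have -> : K * m = K * (1 + 2 * C0 + 6 * C / K) + 2 * c1.
    by rewrite /m; field; rewrite gt_eqF.
  by rewrite ltrDr mulr_gt0//; move: (h1) (h2); set z1 := _ / K; lra.
exists m => // A B g psi y th X A1 g1 gB y1 th0 my mth HX.
have B1 : 1 <= B by nra.
have mm : m <= m ^+ 2 by nra.
have psim : m ^+ 2 <= psi.
  by apply: le_trans my; rewrite ler_peMr ?sqr_ge0//; nra.
have psi0 : 0 < psi by lra.
have X1 : psi / 2 + c2 * B <= - X by nra.
have X2 : k * (psi ^+ 2 + B ^+ 2) <= X ^+ 2.
  have cB : 0 <= c2 * B by nra.
  have : (psi / 2 + c2 * B) ^+ 2 <= X ^+ 2.
    by rewrite -[X ^+ 2]sqrrN ler_sqr ?nnegrE; lra.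
  have : (psi / 2 + c2 * B) ^+ 2 = psi ^+ 2 / 4 + c2 ^+ 2 * B ^+ 2 + psi * (c2 * B) by field.
  have := sqr_ge0 psi; have := sqr_ge0 B; nra.
pose Z := psi ^+ 2 + B ^+ 2.
have Z0 : 0 <= Z by rewrite addr_ge0// sqr_ge0.
have mZ : m <= Z by have := sqr_ge0 B; rewrite /Z; nra.
have psiT z : m * z <= psi -> m * (psi * z) <= Z.
  move=> mz; rewrite mulrCA (le_trans (y := psi * psi))//.
    by rewrite ler_pM2l.
  by rewrite -expr2 lerDl sqr_ge0.
have T1 : m * (psi * th) <= Z by apply: psiT; nra.
have T2 : m * (psi * y ^+ 2) <= Z by apply: psiT; have := sqr_ge0 y; nra.
(* With x = sqrt psi one has m y <= x, so the drift term is at most g x^3 <= x^4 + g^4, and g^4 <=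
   B^2. *)
have T3 : m * (g * psi * y) <= Z.
  pose x := Num.sqrt psi.
  have x0 : 0 <= x by exact: sqrtr_ge0.
  have xx : x ^+ 2 = psi by rewrite sqr_sqrtr// ltW.
  have myx : m * y <= x.
    have : (m * y) ^+ 2 <= x ^+ 2 by rewrite xx exprMn.
    by rewrite ler_sqr ?nnegrE//; nra.
  have j1 : m * (g * psi * y) <= g * x ^+ 3.
    have -> : m * (g * psi * y) = (g * psi) * (m * y) by ring.
    have -> : g * x ^+ 3 = (g * psi) * x by rewrite -xx; ring.
    by rewrite ler_pM2l// mulr_gt0//; lra.
  have j2 : g * x ^+ 3 <= x ^+ 4 + g ^+ 4.
    have [gx|xg] := leP g x.
      have : g * x ^+ 3 <= x * x ^+ 3 by rewrite ler_wpM2r// exprn_ge0.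
      by have := exprn_ge0 4 (le_trans ler01 g1); rewrite -exprS; lra.
    have : x ^+ 3 <= g ^+ 3 by rewrite lerXn2r ?nnegrE//; lra.
    have := exprn_ge0 4 x0 => ? h.
    have : g * x ^+ 3 <= g * g ^+ 3 by rewrite ler_wpM2l//; lra.
    by rewrite -exprS; lra.
  have j3 : x ^+ 4 = psi ^+ 2 by rewrite -xx -exprM.
  have j4 : g ^+ 4 <= B ^+ 2.
    have -> : g ^+ 4 = (g ^+ 2) ^+ 2 by rewrite -exprM.
    by rewrite ler_sqr ?nnegrE ?sqr_ge0//; lra.
  by rewrite /Z; lra.
set W := psi * th + psi * y ^+ 2 + g * psi * y.
have mW : m * W <= 3 * Z.
  have -> : m * W = m * (psi * th) + m * (psi * y ^+ 2) + m * (g * psi * y).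
    by rewrite /W; ring.
  lra.
have goal' : C * W < c1 * (X ^+ 2 / N - 1).
  have e1 : K * Z <= c1 * (X ^+ 2 / N).
    have -> : K * Z = c1 * (k * Z / N) by rewrite /K; field; rewrite gt_eqF.
    by rewrite ler_pM2l// ler_pM2r ?invr_gt0.
  have e2 : C * W <= K * Z / 2.
    have m0 : 0 < m by lra.
    rewrite -(ler_pM2l m0) mulrCA.
    apply: (@le_trans _ _ (C * (3 * Z))); first by rewrite ler_wpM2l.
    have -> : m * (K * Z / 2) = (K * m) * Z / 2 by ring.
    nra.
  have e3 : c1 < K * Z / 2.
    have : K * m <= K * Z by rewrite ler_pM2l.
    lra.
  lra.
have -> : C * A * W = A * (C * W) by ring.
have -> : c1 * A * (X ^+ 2 / N - 1) = A * (c1 * (X ^+ 2 / N - 1)) by ring.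
by rewrite ltr_pM2l//; lra.
Qed.

End powers.

(** * Conditions at a touching point *)

Section touching.
Set Implicit Arguments. Unset Strict Implicit. Unset Printing Implicit Defensive.
Local Open Scope classical_set_scope.
Local Open Scope ring_scope.
Context {R : realType}.

(** Linearises |z|^(2P) with coefficients near its gradient at q, uniformly for bounded q; these
    become the drifts of the equations for the quotients. Uniform continuity of z^(P-1) is used
    because this function is not Lipschitz at 0 when P < 2. *)
Lemma pow_sum_slope n (P Q e : R) : 1 < P -> 0 <= Q -> 0 < e ->
  exists2 d : R, 0 < d & forall q q' : 'I_n -> R,
    (forall j, `|q j| <= Q) -> (forall j, `|q' j - q j| <= d) ->
    exists2 B : 'I_n -> R,
      powR (\sum_(j < n) q' j ^+ 2) P - powR (\sum_(j < n) q j ^+ 2) P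
        = \sum_(j < n) B j * (q' j - q j) &
      forall j, `|B j - 2 * P * powR (\sum_(j < n) q j ^+ 2) (P - 1) * q j| <= e.
Proof.
move=> P1 Q0 e0.
pose N := n%:R * Q ^+ 2 : R.
have N0 : 0 <= N by rewrite mulr_ge0// sqr_ge0.
pose e1 := e / (2 * P * (2 * Q + 1)).
have PQ0 : 0 < 2 * P * (2 * Q + 1) by rewrite !mulr_gt0//; lra.
have e10 : 0 < e1 by rewrite divr_gt0.
have r0 : 0 < P - 1 by lra.
have [d1 d10 H1] : exists2 d1 : R, 0 < d1 & forall x, 0 <= x <= N ->
    forall y, `|y - x| < d1 -> `|powR `|y| (P - 1) - powR `|x| (P - 1)| < e1.
  have := @compact_uniformly_continuous R R `[0, N] (fun x => powR `|x| (P - 1)) e1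
    (@segment_compact _ _ _) (fun x _ => @powR_norm_continuous R _ r0 x) e10.
  rewrite near_withinE => /nbhs_ballP[d1 /= d10 H1].
  have d2 : 0 < d1 / 2 by rewrite divr_gt0.
  exists (d1 / 2) => // x x0 y yx; apply: (H1 (d1 / 2)) => //.
  - by rewrite /ball/= sub0r normrN gtr0_norm//; lra.
  - by rewrite /ball/= distrC.
pose K := powR N (P - 1).
have K0 : 0 <= K by exact: powR_ge0.
(* The three bounds serve, in order, to keep q' + q within 2 Q + 1, to replace q' + q by 2 q in the
   coefficient, and to replace c by s under z^(P-1). *)
pose d := Num.min 1 (Num.min (e / (2 * P * (K + 1))) (d1 / 2 / (n%:R * (2 * Q + 1) + 1))).
have nQ0 : 0 <= n%:R * (2 * Q + 1) by rewrite mulr_ge0//; lra.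
have PK0 : 0 < 2 * P * (K + 1) by rewrite !mulr_gt0//; lra.
have d0 : 0 < d.
  by rewrite !lt_min ltr01 divr_gt0//= divr_gt0//; lra.
have d1' : d <= 1 by rewrite ge_min lexx.
have de : P * (K + 1) * d <= e / 2.
  have : d <= e / (2 * P * (K + 1)) by rewrite !ge_min lexx orbT.
  by rewrite ler_pdivlMr//; lra.
have dd1 : n%:R * (2 * Q + 1) * d < d1.
  have : d <= d1 / 2 / (n%:R * (2 * Q + 1) + 1) by rewrite !ge_min lexx !orbT.
  by rewrite ler_pdivlMr; lra.
exists d => // q q' qQ qd.
set s := \sum_(j < n) q j ^+ 2; set s' := \sum_(j < n) q' j ^+ 2.
have s0 : 0 <= s by apply: sumr_ge0 => i _; rewrite sqr_ge0.
have s'0 : 0 <= s' by apply: sumr_ge0 => i _; rewrite sqr_ge0.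
have sN : s <= N.
  apply: (@le_trans _ _ (\sum_(j < n) Q ^+ 2)).
    apply: ler_sum => j _; rewrite -[leLHS]ger0_norm ?sqr_ge0// normrX.
    by rewrite ler_sqr ?nnegrE.
  by rewrite sumr_const card_ord -mulr_natl.
have qq j : `|q' j + q j| <= 2 * Q + 1.
  have -> : q' j + q j = (q' j - q j) + 2 * q j by ring.
  apply: (le_trans (ler_normD _ _)); rewrite normrM ger0_norm//.
  by have := qQ j; have := qd j; lra.
have ss : s' - s = \sum_(j < n) (q' j + q j) * (q' j - q j).
  by rewrite /s' /s -sumrB; apply: eq_bigr => j _; ring.
have ssd : `|s' - s| < d1.
  apply: le_lt_trans dd1; rewrite ss; apply: (le_trans (ler_norm_sum _ _ _)).
  apply: (@le_trans _ _ (\sum_(j < n) (2 * Q + 1) * d)).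
    by apply: ler_sum => j _; rewrite normrM; apply: ler_pM.
  by rewrite sumr_const card_ord -[leLHS]mulr_natl mulrA.
have [c [c1 c2 E]] := powR_slope P1 s0 s'0.
have c0 : 0 <= c by apply: le_trans c1; rewrite le_min s0.
have cs : `|c - s| < d1.
  apply: le_lt_trans ssd; move: c1 c2; case: (leP s s') => h c1 c2.
    by rewrite ger0_norm ?ger0_norm; lra.
  by rewrite ler0_norm ?ler0_norm; lra.
exists (fun j => P * powR c (P - 1) * (q' j + q j)).
  rewrite E ss mulr_sumr; apply: eq_bigr => j _; ring.
move=> j.
have -> : P * powR c (P - 1) * (q' j + q j) - 2 * P * powR s (P - 1) * q j =
  P * (powR c (P - 1) - powR s (P - 1)) * (q' j + q j)
    + P * powR s (P - 1) * (q' j - q j) by ring.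
apply: (le_trans (ler_normD _ _)).
have P0 : 0 <= P by lra.
have A : `|P * (powR c (P - 1) - powR s (P - 1)) * (q' j + q j)| <= e / 2.
  have s0N : 0 <= s <= N by rewrite s0.
  have := H1 s s0N c cs; rewrite (ger0_norm c0) (ger0_norm s0) => cse.
  have -> : e / 2 = P * e1 * (2 * Q + 1).
    by rewrite /e1; field; rewrite !gt_eqF//; lra.
  rewrite !normrM (ger0_norm P0); apply: ler_pM => //.
    by rewrite mulr_ge0.
  by rewrite ler_wpM2l// ltW.
have B : `|P * powR s (P - 1) * (q' j - q j)| <= e / 2.
  apply: le_trans de; rewrite !normrM (ger0_norm P0).
  apply: ler_pM => //; first by rewrite mulr_ge0.
  rewrite ler_wpM2l// ger0_norm ?powR_ge0//.
  have : powR s (P - 1) <= K by apply: ge0_ler_powR; rewrite ?nnegrE// ltW.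
  lra.
lra.
Qed.

(** Along a coordinate line f stands for 9/16 - |x|^2, and the time factor of the barrier is part of
    k. The values at 0 are the separate families [v0] and [w0], so that the conclusion can be
    obtained free of shifts by 0 in these terms. *)
Lemma space_touching n (v v1 : 'I_n -> R -> R) (v2 : 'I_n -> R)
    (D D1 f f1 : R -> R) (D2 f2 a P k e : R) (v0 w0 : 'I_n -> R) :
  (forall i, v i 0 = v0 i) -> (forall i, v1 i 0 = w0 i) ->
  0 < e -> 0 <= a -> 1 < P ->
  (forall (s : R) i, `|s| < e -> is_derive s 1 (v i) (v1 i s)) ->
  (forall s : R, `|s| < e -> is_derive s 1 D (D1 s)) ->
  (forall s : R, `|s| < e -> is_derive s 1 f (f1 s)) ->
  (forall i, is_derive (0 : R) 1 (v1 i) (v2 i)) ->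
  is_derive (0 : R) 1 D1 D2 -> is_derive (0 : R) 1 f1 f2 ->
  (forall s, `|s| < e -> 0 < f s) ->
  (forall s, `|s| < e ->
    a * powR (1 + \sum_(i < n) v i s ^+ 2) P - D s - k * (f s)^-1 ^+ 2 <=
    a * powR (1 + \sum_(i < n) v i 0 ^+ 2) P - D 0 - k * (f 0)^-1 ^+ 2) ->
  let F := a * P * powR (1 + \sum_(i < n) v0 i ^+ 2) (P - 1) in
  D1 0 = 2 * F * \sum_(i < n) v0 i * w0 i + 2 * k * (f 0)^-1 ^+ 3 * f1 0 /\
  2 * F * (\sum_(i < n) w0 i ^+ 2 + \sum_(i < n) v0 i * v2 i) - D2
    <= k * (6 * (f 0)^-1 ^+ 4 * f1 0 ^+ 2 - 2 * (f 0)^-1 ^+ 3 * f2).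
Proof.
move=> /funext <- /funext <-; move=> e0 a0 P1 dv dD df dv1 dD1 df1 fpos fmax F.
have e00 : `|0 : R| < e by rewrite normr0.
pose S s := 1 + \sum_(i < n) v i s ^+ 2.
have S0 s : 0 < S s.
  by rewrite ltr_pwDl// sumr_ge0// => i _; rewrite sqr_ge0.
pose S1 s := \sum_(i < n) 2 * v i s * v1 i s.
have dS (s : R) : `|s| < e -> is_derive s 1 S (S1 s).
  move=> se; have := @is_derive1D R (fun=> 1) (fun s => \sum_(i < n) v i s ^+ 2)
    s 0 (S1 s) (is_derive_cst _ _ _) _.
  by rewrite add0r; apply; apply: is_derive1_sum => i; apply: is_derive1X2; exact: dv.
have dpow r (s : R) : `|s| < e ->
    is_derive s 1 (fun s => powR (S s) r) (r * powR (S s) (r - 1) * S1 s).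
  move=> se; apply: (@is_derive1_compose _ (fun z => powR z r)); last exact: dS.
  exact: is_derive1_powR.
pose r s := (f s)^-1.
have dr (s : R) : `|s| < e -> is_derive s 1 r (- (r s ^+ 2 * f1 s)).
  move=> se; have Dr := @is_deriveV R f s _ 1 (lt0r_neq0 (fpos s se)) (df s se).
  by apply: (is_derive_eq Dr); rewrite /GRing.scale/= /r exprVn mulNr.
pose f' s := a * (P * powR (S s) (P - 1) * S1 s) - D1 s
             - k * (2 * r s * (- (r s ^+ 2 * f1 s))).
have dS1 : is_derive (0 : R) 1 S1
    (\sum_(i < n) (2 * v1 i 0 * v1 i 0 + 2 * v i 0 * v2 i)).
  apply: is_derive1_sum => i; apply: (@is_derive1M R (fun s => 2 * v i s)) => //.
  by apply: is_derive1Z; exact: dv.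
have A1 := @is_derive1Z R a _ _ _ (@is_derive1M R _ _ _ _ _
   (@is_derive1Z R P _ _ _ (dpow (P - 1) 0 e00)) dS1).
have A2 := @is_derive1Z R k _ _ _ (@is_derive1M R _ _ _ _ _
   (@is_derive1Z R 2 _ _ _ (dr 0 e00))
   (is_deriveN (@is_derive1M R _ _ _ _ _ (is_derive1X2 (dr 0 e00)) df1))).
have A := is_derive1B (is_derive1B A1 dD1) A2.
have Df (s : R) : `|s| < e -> is_derive s 1 (fun s => a * powR (S s) P - D s - k * r s ^+ 2) (f' s).
  move=> se; apply: is_derive1B; first apply: is_derive1B; last 2 first.
  - exact: dD.
  - by apply: is_derive1Z; apply: is_derive1X2; exact: dr.
  by apply: is_derive1Z; exact: dpow.
have nb : \forall y \near (0 : R), `|y| < e by exact: nbhs0_lt.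
have N1 : \forall s \near (0 : R),
    is_derive (s : R) 1 (fun s => a * powR (S s) P - D s - k * r s ^+ 2) (f' s).
  by near=> s; apply: Df; near: s.
have N2 : \forall s \near (0 : R),
    a * powR (S s) P - D s - k * r s ^+ 2 <= a * powR (S 0) P - D 0 - k * r 0 ^+ 2.
  by near=> s; apply: fmax; near: s.
have {N1 N2} [H1 H2] := local_max_deriv N1 A N2.
have S1E : S1 0 = 2 * \sum_(i < n) v i 0 * v1 i 0.
  by rewrite /S1 mulr_sumr; apply: eq_bigr => i _; rewrite mulrA.
move: H1 H2; rewrite /f' /F -/(S 0) -/(r 0) S1E => H1 H2; split; first by lra.
(* This part of the second derivative comes from the convexity of z^P; it has the good sign and is
   dropped. *)
have S10 : 0 <= a * (P * (P - 1) * powR (S 0) (P - 1 - 1)) * S1 0 ^+ 2.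
  rewrite mulr_ge0 ?sqr_ge0// mulr_ge0// mulr_ge0 ?powR_ge0// mulr_ge0//; lra.
have E : \sum_(i < n) (2 * v1 i 0 * v1 i 0 + 2 * v i 0 * v2 i) =
    2 * (\sum_(i < n) v1 i 0 ^+ 2 + \sum_(i < n) v i 0 * v2 i).
  by rewrite -big_split/= mulr_sumr; apply: eq_bigr => i _; ring.
move: H2; rewrite E /=.
have -> : (- (fun y : R => r y ^+ 2 * f1 y)) 0 = - (r 0 ^+ 2 * f1 0) by [].
move: S10; rewrite S1E.
move: (S 0 `^ _) (S 0 `^ _) (r 0) (\sum_(_ < n) _) (\sum_(_ < n) _) (\sum_(_ < n) _).
clear; move=> *; nra.
Unshelve. all: by end_near. Qed.

Lemma time_touching n (v : 'I_n -> R -> R) (v1 : 'I_n -> R)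
    (D : R -> R) (D1 a P k t0 t : R) :
  t0 < t -> 1 < P ->
  (forall i, is_derive t 1 (v i) (v1 i)) -> is_derive t 1 D D1 ->
  (\forall s \near t^'-,
    a * powR (1 + \sum_(i < n) v i s ^+ 2) P - D s - k * (s - t0)^-1 <=
    a * powR (1 + \sum_(i < n) v i t ^+ 2) P - D t - k * (t - t0)^-1) ->
  D1 <= 2 * (a * P * powR (1 + \sum_(i < n) v i t ^+ 2) (P - 1))
          * \sum_(i < n) v i t * v1 i + k * (t - t0)^-1 ^+ 2.
Proof.
move=> tt P1 dv dD fmax.
pose S s := 1 + \sum_(i < n) v i s ^+ 2.
have S0 s : 0 < S s.
  by rewrite ltr_pwDl// sumr_ge0// => i _; rewrite sqr_ge0.
have dS : is_derive t 1 S (\sum_(i < n) 2 * v i t * v1 i).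
  have := @is_derive1D R (fun=> 1) (fun s => \sum_(i < n) v i s ^+ 2)
    t 0 _ (is_derive_cst _ _ _) _.
  by move=> H; rewrite -[\sum_(_ < _) _]add0r; apply: H; apply: is_derive1_sum => i; apply: is_derive1X2.
have A1 := @is_derive1Z R a _ _ _
  (@is_derive1_compose R (fun z => powR z P) S t _ _ (is_derive1_powR P (S0 t)) dS).
have dl : is_derive t 1 (fun s => s - t0) 1.
  by rewrite -[X in is_derive _ _ _ X]subr0; apply: is_derive1B.
have dr : is_derive t 1 (fun s => (s - t0)^-1) (- (t - t0)^-1 ^+ 2).
  have tn : t - t0 != 0 by rewrite subr_eq0 gt_eqF.
  have Dr := @is_deriveV R (fun s => s - t0) t _ 1 tn dl.
  by apply: (is_derive_eq Dr); rewrite /GRing.scale/= mulr1 exprVn.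
have A := near_left_ge0 (is_derive1B (is_derive1B A1 dD) (is_derive1Z k dr)) fmax.
have E : \sum_(i < n) 2 * v i t * v1 i = 2 * \sum_(i < n) v i t * v1 i.
  by rewrite mulr_sumr; apply: eq_bigr => i _; rewrite mulrA.
move: A; rewrite E -/(S t); lra.
Qed.

(* [psi = k y^2 th] is the value of the barrier k (9/16 - |x|^2)^-2 (t - t0)^-1 with
   y = (9/16 - |x|^2)^-1 and th = (t - t0)^-1; its j-th derivative is 4 psi y x_j.
   W i j, L i j and vt i are the first, second and time derivatives of v i, and
   D j, D2 j and Dt those of the time quotient. *)
Lemma touching_algebra n (F psi y th : R) (v vt D x b : 'I_n -> R)
    (W L B : 'I_n -> 'I_n -> R) (D2 : 'I_n -> R) (Dt : R) :
  0 <= F -> 0 <= psi -> 1 <= y -> \sum_(j < n) x j ^+ 2 <= 1 ->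
  (forall j, D j = 2 * F * \sum_(i < n) v i * W i j - 4 * psi * y * x j) ->
  (forall j, 2 * F * (\sum_(i < n) W i j ^+ 2 + \sum_(i < n) v i * L i j) - D2 j
     <= psi * (24 * y ^+ 2 * x j ^+ 2 + 4 * y)) ->
  Dt <= 2 * F * \sum_(i < n) v i * vt i + psi * th ->
  (forall i, vt i - \sum_(j < n) L i j = \sum_(j < n) B i j * W i j) ->
  Dt - \sum_(j < n) D2 j = \sum_(j < n) b j * D j ->
  F * (\sum_(i < n) \sum_(j < n) W i j ^+ 2
       - \sum_(i < n) \sum_(j < n) v i ^+ 2 * (B i j - b j) ^+ 2)
    <= psi * th + (24 + 4 * n%:R) * psi * y ^+ 2
       + 4 * psi * y * \sum_(j < n) `|b j|.
Proof.
move=> F0 psi0 y1 x1 HD HL Ht Ev ED.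
have x1j j : `|x j| <= 1.
  rewrite -(@ler_sqr _ `|x j|) ?nnegrE// real_normK ?num_real// expr1n.
  apply: le_trans x1; rewrite (bigD1 j)//= lerDl.
  by apply: sumr_ge0 => i _; rewrite sqr_ge0.
pose W2 := \sum_(i < n) \sum_(j < n) W i j ^+ 2.
have H1 : 2 * F * (W2 + \sum_(j < n) \sum_(i < n) v i * L i j) - \sum_(j < n) D2 j
    <= psi * (24 * y ^+ 2) + 4 * psi * y * n%:R.
  rewrite /W2 exchange_big/= -big_split/= mulr_sumr -sumrB.
  apply: (le_trans (ler_sum _ (fun j _ => HL j))).
  rewrite -mulr_sumr big_split/= -mulr_sumr sumr_const card_ord -[_ *+ n]mulr_natr.
  have := ler_wpM2l (mulr_ge0 (ler0n R 24) (sqr_ge0 y)) x1 => h.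
  by have := ler_wpM2l psi0 h; lra.
(* The equations of the space quotients, weighted by v i, leave only their drift terms. *)
have E1 : \sum_(i < n) v i * vt i - \sum_(j < n) \sum_(i < n) v i * L i j =
    \sum_(i < n) \sum_(j < n) v i * (B i j * W i j).
  rewrite exchange_big/= -sumrB; apply: eq_bigr => i _.
  by rewrite -!mulr_sumr -mulrBr Ev.
have E2 : \sum_(j < n) b j * D j =
    2 * F * (\sum_(i < n) \sum_(j < n) v i * (b j * W i j))
    - 4 * psi * y * \sum_(j < n) b j * x j.
  rewrite exchange_big/= !mulr_sumr -sumrB; apply: eq_bigr => j _.
  rewrite HD mulrBr mulr_sumr mulr_sumr mulr_sumr; congr (_ - _); last by ring.
  by apply: eq_bigr => i _; ring.
have H2 : \sum_(j < n) b j * x j <= \sum_(j < n) `|b j|.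
  apply: ler_sum => j _; apply: le_trans (ler_norm _) _.
  by rewrite normrM ler_piMr.
(* Young's inequality for 2 v (B - b) W. It spends one of the two F W^2 at hand, so the drifts only
   have to be close to each other. *)
have H3 : 2 * (\sum_(i < n) \sum_(j < n) v i * (B i j * W i j)
      - \sum_(i < n) \sum_(j < n) v i * (b j * W i j)) <=
   W2 + \sum_(i < n) \sum_(j < n) v i ^+ 2 * (B i j - b j) ^+ 2.
  rewrite /W2 -big_split/= -sumrB mulr_sumr; apply: ler_sum => i _.
  rewrite -big_split/= -sumrB mulr_sumr; apply: ler_sum => j _.
  by have := sqr_ge0 (W i j - v i * (B i j - b j)); nra.
have H4 := ler_wpM2l F0 H3.
have py0 : 0 <= 4 * psi * y by rewrite !mulr_ge0//; lra.
have H5 := ler_wpM2l py0 H2.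
have H6 : 4 * psi * y * n%:R <= 4 * psi * y ^+ 2 * n%:R.
  rewrite ler_wpM2r// ler_wpM2l ?mulr_ge0//.
  by rewrite expr2 ler_peMl//; lra.
move: E2 H1 Ht H4 H5 H6 ED; rewrite -/W2.
have -> : \sum_(i < n) v i * vt i = \sum_(j < n) \sum_(i < n) v i * L i j +
    \sum_(i < n) \sum_(j < n) v i * (B i j * W i j) by rewrite -E1; ring.
clear H2 H3 E1.
move: W2 (\sum_(j < n) \sum_(i < n) v i * L i j)
  (\sum_(i < n) \sum_(j < n) v i * (B i j * W i j))
  (\sum_(i < n) \sum_(j < n) v i * (b j * W i j))
  (\sum_(i < n) \sum_(j < n) v i ^+ 2 * (B i j - b j) ^+ 2) => W2 w1 w2 w3 w4.
move: (\sum_(j < n) b j * D j) (\sum_(j < n) b j * x j) (\sum_(j < n) `|b j|)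
  (\sum_(j < n) D2 j) => w5 w6 w7 w8.
clear; lra.
Qed.

End touching.

(** * Incompatibility of the touching conditions with a large barrier *)

Section contradiction.
Set Implicit Arguments. Unset Strict Implicit. Unset Printing Implicit Defensive.
Local Open Scope ring_scope.
Context {R : realType}.

(** The sum X of the W i i is within 1 of D - s^P, so [power_gap] makes -X at least psi + c (1 +
    s)^P - C. By Cauchy-Schwarz X^2 bounds the Hessian term from below, and [barrier_absorption]
    makes the barrier terms strictly smaller. All error bounds in the hypotheses are absolute
    numbers, so m depends on n, a, P only. *)
Lemma touching_contradiction n (a P : R) : 2^-1 <= a -> a < 1 -> 1 < P ->
  exists2 m : R, 1 <= m & forall (q v b : 'I_n -> R) (W B : 'I_n -> 'I_n -> R)
      (D psi y th : R),
    let s := \sum_(i < n) q i ^+ 2 in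
    let S := \sum_(i < n) v i ^+ 2 in
    let F := a * P * powR (1 + S) (P - 1) in
    1 <= y -> 0 <= th -> m ^+ 2 * y ^+ 2 <= psi -> m ^+ 2 * th <= psi ->
    `|S - s| <= 2^-1 -> a * powR (1 + S) P - D = psi ->
    `|\sum_(i < n) W i i - (D - powR s P)| <= 1 ->
    (forall j, `|b j - 2 * P * powR s (P - 1) * q j| <= 1) ->
    \sum_(i < n) \sum_(j < n) v i ^+ 2 * (B i j - b j) ^+ 2 <= 1 ->
    F * (\sum_(i < n) \sum_(j < n) W i j ^+ 2
         - \sum_(i < n) \sum_(j < n) v i ^+ 2 * (B i j - b j) ^+ 2)
      <= psi * th + (24 + 4 * n%:R) * psi * y ^+ 2
         + 4 * psi * y * \sum_(j < n) `|b j| ->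
    False.
Proof.
move=> a2 a1 P1.
have a0 : 0 <= a by lra.
have P0 : 0 <= P by lra.
have Pm : 0 <= P - 1 by lra.
have P21 : 0 <= 2 * P + 1 by lra.
have [c2 [C0 [c20 C00 gap]]] := power_gap a2 a1 (ltW P1).
(* From |S - s| <= 1/2 follows 1 + S >= (1 + s)/2, hence F >= c1 (1 + s)^(P-1). *)
pose c1 := a * P * powR 2^-1 (P - 1).
have c10 : 0 < c1 by rewrite !mulr_gt0 ?powR_gt0//; lra.
pose n' : R := n%:R.
have n0 : 0 <= n' by exact: ler0n.
(* The coefficients of psi th, of psi y^2 and of the drift term, the last one from |b j| <= (2 P +
   1) A g. *)
pose C := 1 + (24 + 4 * n') + 4 * n' * (2 * P + 1).
have nP0 : 0 <= 4 * n' * (2 * P + 1) by rewrite !mulr_ge0//; lra.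
have C_0 : 0 <= C by rewrite /C; lra.
(* The divisor is n + 1 rather than n so as to be positive in dimension 0 too. *)
have N0 : 0 < n' + 1 by lra.
have C01 : 0 <= C0 + 1 by lra.
have [m m1 Hm] := barrier_absorption c10 c20 C_0 C01 N0.
exists m => // q v b W B D psi y th s S F y1 th0 my mth Ss Epsi HX Hb HE HF.
have s0 : 0 <= s by apply: sumr_ge0 => i _; rewrite sqr_ge0.
have S0 : 0 <= S by apply: sumr_ge0 => i _; rewrite sqr_ge0.
have y0 : 0 <= y by apply: le_trans y1.
have s1 : 0 <= 1 + s by rewrite addr_ge0.
have S1 : 0 <= 1 + S by rewrite addr_ge0.
pose A := powR (1 + s) (P - 1).
pose g := Num.sqrt (1 + s).
have gg : g ^+ 2 = 1 + s by rewrite sqr_sqrtr.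
have g1 : 1 <= g.
  have : (1 : R) ^+ 2 <= g ^+ 2 by rewrite gg expr1n lerDl.
  by rewrite ler_sqr ?nnegrE ?sqrtr_ge0.
have g0 : 0 <= g by exact: sqrtr_ge0.
have A1 : 1 <= A.
  by rewrite -[leLHS](powRr0 (1 + s)); apply: ler_powR; rewrite ?lerDl.
have A0 : 0 <= A by exact: powR_ge0.
have gB : g ^+ 2 <= powR (1 + s) P by rewrite gg le1r_powR// ?lerDl// ltW.
move: Ss; rewrite ler_norml => /andP[Ss1 Ss2].
have X1 : psi + c2 * powR (1 + s) P - (C0 + 1) <= - \sum_(i < n) W i i.
  have := gap s s0.
  have : powR (1 + S) P <= powR (3 / 2 + s) P.
    by apply: ge0_ler_powR; rewrite ?nnegrE//; [rewrite addr_ge0 ?divr_ge0|move: Ss2; clear; lra].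
  move=> /(ler_wpM2l a0); move: HX; rewrite ler_norml => /andP[_]; move: Epsi; clear; lra.
have := Hm A _ g psi y th _ A1 g1 gB y1 th0 my mth X1.
set X := \sum_(i < n) W i i; apply/negP; rewrite -leNgt.
have F1 : c1 * A <= F.
  rewrite /c1 /F /A -mulrA -powRM ?invr_ge0//.
  rewrite ler_wpM2l ?mulr_ge0//.
  by apply: ge0_ler_powR; rewrite ?nnegrE ?mulr_ge0 ?invr_ge0//; move: Ss1 s0; clear; lra.
set E := \sum_(i < n) \sum_(j < n) v i ^+ 2 * _ in HE HF.
set W2 := \sum_(i < n) \sum_(j < n) W i j ^+ 2 in HF.
have W2X : X ^+ 2 / (n' + 1) <= W2.
  rewrite ler_pdivrMr//; apply: (le_trans (sqr_sum_le _)).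
  have W20 : \sum_(i < n) W i i ^+ 2 <= W2.
    apply: ler_sum => i _; rewrite (bigD1 i)//= lerDl.
    by apply: sumr_ge0 => j _; rewrite sqr_ge0.
  have : 0 <= \sum_(i < n) W i i ^+ 2 by apply: sumr_ge0 => i _; rewrite sqr_ge0.
  by rewrite -/n'; move: W20 n0; clear; nra.
have psi0 : 0 <= psi by apply: le_trans my; rewrite mulr_ge0// sqr_ge0.
have bj j : `|b j| <= (2 * P + 1) * (A * g).
  have q_g : `|q j| <= g.
    rewrite -ler_sqr ?nnegrE ?sqrtr_ge0// gg real_normK ?num_real//.
    rewrite /s (bigD1 j)//= [leRHS]addrCA lerDl addr_ge0//.
    by apply: sumr_ge0 => i _; rewrite sqr_ge0.
  have sA : powR s (P - 1) <= A by apply: ge0_ler_powR; rewrite ?nnegrE// lerDr.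
  have Ag1 : 1 <= A * g by move: A1 g1; clear; nra.
  have h : `|2 * P * powR s (P - 1) * q j| <= 2 * P * (A * g).
    have -> : 2 * P * powR s (P - 1) * q j = 2 * P * (powR s (P - 1) * q j) by ring.
    have P20 : 0 <= 2 * P by rewrite mulr_ge0.
    rewrite normrM (ger0_norm P20) ler_wpM2l// normrM (ger0_norm (powR_ge0 _ _)).
    by apply: ler_pM => //; exact: powR_ge0.
  have := Hb j; have := ler_normD (b j - 2 * P * powR s (P - 1) * q j) (2 * P * powR s (P - 1) * q j).
  rewrite subrK; move: h Ag1; clear; lra.
have bs : \sum_(j < n) `|b j| <= n' * ((2 * P + 1) * (A * g)).
  apply: (le_trans (ler_sum _ (fun j _ => bj j))).
  by rewrite sumr_const card_ord -[leLHS]mulr_natl.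
(* F >= c1 A may multiply only a nonnegative factor; if X^2/(n + 1) < 1 the left side is at most 0
   and the bound is immediate. *)
have L1 : c1 * A * (X ^+ 2 / (n' + 1) - 1) <= F * (W2 - E) \/
    X ^+ 2 / (n' + 1) - 1 < 0.
  have [h|h] := lerP 0 (X ^+ 2 / (n' + 1) - 1); [left|by right].
  apply: (@le_trans _ _ (F * (X ^+ 2 / (n' + 1) - 1))); first by rewrite ler_wpM2r.
  rewrite ler_wpM2l//; last by rewrite lerB.
  by rewrite !mulr_ge0 ?powR_ge0.
have t1 : 0 <= psi * th by rewrite mulr_ge0.
have t2 : 0 <= psi * y ^+ 2 by rewrite mulr_ge0 ?sqr_ge0.
have t3 : 0 <= g * psi * y by rewrite !mulr_ge0.
have Cn : 0 <= C * A * (psi * th + psi * y ^+ 2 + g * psi * y).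
  by apply: mulr_ge0; [exact: mulr_ge0|rewrite !addr_ge0].
case: L1 => [L1|L1]; last first.
  by apply: (le_trans _ Cn); rewrite nmulr_lle0// mulr_ge0// ltW.
apply: (le_trans L1); apply: (le_trans HF).
have py0 : 0 <= 4 * psi * y by rewrite !mulr_ge0.
have := ler_wpM2l py0 bs.
have At1 : psi * th <= A * (psi * th) by rewrite ler_peMl.
have At2 : psi * y ^+ 2 <= A * (psi * y ^+ 2) by rewrite ler_peMl.
have At3 : 0 <= A * (g * psi * y) by rewrite mulr_ge0.
move: At1 At2 At3 t1 t2 t3 nP0 n0; rewrite /C.
have -> : 4 * psi * y * (n' * ((2 * P + 1) * (A * g)))
   = (4 * n' * (2 * P + 1)) * (A * (g * psi * y)) by ring.
move: (4 * n' * (2 * P + 1)) => k.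
set z1 := psi * th; set z3 := g * psi * y.
have -> : (24 + 4 * n') * psi * y ^+ 2 = (24 + 4 * n') * (psi * y ^+ 2) by ring.
rewrite -/n'; move: z1 z3 (psi * y ^+ 2) (4 * psi * y * _) => z1 z3 z2 z4.
clear - A1; move: n' A A1; clear => n' A *; nra.
Qed.

End contradiction.

(** * Closed cylinders *)

Lemma continuous_at_sum {R : realType} (X : topologicalType) m (f : 'I_m -> X -> R) (x : X) :
  (forall i, {for x, continuous (f i)}) ->
  {for x, continuous (fun y => \sum_(i < m) f i y)}.
Proof.
move=> cf; have -> : (fun y => \sum_(i < m) f i y) = \sum_(i < m) f i.
  by apply/funext => y; rewrite fct_sumE.
apply: (big_ind (fun g : X -> R => {for x, continuous g})) => //.
- exact: cst_continuous.
- by move=> g h cg ch; exact: (continuousD cg ch).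
Qed.

Section cylinder.
Set Implicit Arguments. Unset Strict Implicit. Unset Printing Implicit Defensive.
Local Open Scope classical_set_scope.
Local Open Scope ring_scope.
Context {R : realType} {n : nat}.
Implicit Types (x y : 'rV[R]_n) (t s : R).

Definition sqnorm x : R := \sum_(i < n) x ord0 i ^+ 2.

Lemma sqnorm_ge0 x : 0 <= sqnorm x.
Proof. by apply: sumr_ge0 => i _; rewrite sqr_ge0. Qed.

Lemma enorm_ge0 x : 0 <= enorm x.
Proof. exact: sqrtr_ge0. Qed.

Lemma enorm_sqr x : enorm x ^+ 2 = sqnorm x.
Proof. by rewrite sqr_sqrtr// sqnorm_ge0. Qed.

Lemma enorm_lt x (r : R) : 0 < r -> (enorm x < r) = (sqnorm x < r ^+ 2).
Proof.
by move=> r0; rewrite -enorm_sqr ltr_sqr// nnegrE ?enorm_ge0// ltW.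
Qed.

Lemma enorm_powR x (p : R) : powR (enorm x) p = powR (sqnorm x) (p / 2).
Proof.
rewrite /enorm -/(sqnorm x) -powR12_sqrt ?sqnorm_ge0// -powRrM.
by rewrite mulrC.
Qed.

Lemma sqnorm_continuous : continuous sqnorm.
Proof.
move=> x; apply: (@continuous_at_sum R _ n (fun i (y : 'rV[R]_n) => y ord0 i ^+ 2)) => i.
have h : {for x, continuous (fun y : 'rV[R]_n => y ord0 i)} by exact: coord_continuous.
exact: (continuousM h h).
Qed.

Lemma sqnorm_line x j s :
  sqnorm (x + s *: ebasis R j) = sqnorm x + 2 * x ord0 j * s + s ^+ 2.
Proof.
rewrite /sqnorm (bigD1 j)//= [in RHS](bigD1 j)//= !mxE !eqxx/=.
rewrite (eq_bigr (fun i => x ord0 i ^+ 2)); first by ring.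
by move=> i ij; rewrite !mxE (negbTE ij) andbF mulr0 addr0.
Qed.

Lemma ball_line x t j s d : `|s| < d -> ball (x, t) d (x + s *: ebasis R j, t).
Proof.
move=> sd; split => /=; last by apply: ballxx; apply: le_lt_trans sd.
split; first by apply: le_lt_trans sd.
move=> i k; rewrite /ball/= !mxE opprD addrA subrr sub0r normrN normrM.
apply: le_lt_trans sd; rewrite ler_piMr//.
by case: (_ && _); rewrite ?normr0 ?normr1.
Qed.

Lemma ball_time x t t' d : `|t' - t| < d -> ball (x, t) d (x, t').
Proof.
move=> sd; split => /=; first by apply: ballxx; apply: le_lt_trans sd.
by rewrite /ball/= distrC.
Qed.

(** [r2] is the squared radius. It will be 9/16, for the radius 3/4 between 1/2, where the estimate
    is wanted, and 1, where the solution lives. *)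
Definition cyl (r2 t0 t1 : R) : set ('rV[R]_n * R) :=
  [set x | sqnorm x <= r2] `*` `[t0, t1].

Lemma cyl_compact r2 t0 t1 : r2 <= 1 -> compact (cyl r2 t0 t1).
Proof.
move=> r1; apply: compact_setX; last exact: segment_compact.
apply: (@subclosed_compact _ _ [set v : 'rV[R]_n | forall i, `[-1, 1]%classic (v ord0 i)]).
- have -> : [set x | sqnorm x <= r2] = sqnorm @^-1` [set z | z <= r2] by [].
  refine (@preimage_closed _ _ sqnorm [set z : R | z <= r2] _ (@closed_le R r2)).
  by move=> x _; exact: sqnorm_continuous.
- exact: (@rV_compact R n (fun=> `[-1, 1]%classic) (fun=> @segment_compact R _ _)).
move=> x /= xr i; rewrite in_itv/= -ler_norml -(@ler_sqr _ `|_|) ?nnegrE//.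
rewrite real_normK ?num_real// expr1n; apply: le_trans (le_trans xr r1).
rewrite /sqnorm (bigD1 i)//= lerDl.
by apply: sumr_ge0 => j _; rewrite sqr_ge0.
Qed.

End cylinder.

(** * Difference quotients of a solution *)

Section unit_cylinder.
Set Implicit Arguments. Unset Strict Implicit. Unset Printing Implicit Defensive.
Local Open Scope classical_set_scope.
Local Open Scope ring_scope.
Context {R : realType} {n : nat}.
Implicit Types (x y : 'rV[R]_n) (t s r T : R) (u : 'rV[R]_n -> R -> R).

Lemma is_derive_dx r T u x t j s : C21 r T u -> inQ r T (x + s *: ebasis R j) t ->
  is_derive s 1 (fun s => u (x + s *: ebasis R j) t)
    (dx u j (x + s *: ebasis R j) t).
Proof.
move=> cu /cu[[du _] _ _ _ _].
exact: (is_derive_line (g := fun y => u y t) (du j)).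
Qed.

Lemma is_derive_dxx r T u x t i j s : C21 r T u -> inQ r T (x + s *: ebasis R j) t ->
  is_derive s 1 (fun s => dx u i (x + s *: ebasis R j) t)
    (dxx u i j (x + s *: ebasis R j) t).
Proof.
move=> cu /cu[[_ [du _]] _ _ _ _].
exact: (is_derive_line (g := fun y => dx u i y t) (du i j)).
Qed.

Lemma is_derive_dt r T u x t : C21 r T u -> inQ r T x t ->
  is_derive t 1 (u x) (dt u x t).
Proof. by move=> cu /cu[[_ [_ du]] _ _ _ _]; exact: derivableP. Qed.

Lemma pde p r T u x t : classical_solution p r T u -> inQ r T x t ->
  dt u x t - \sum_(i < n) dxx u i i x t
    = powR (\sum_(i < n) dx u i x t ^+ 2) (p / 2).
Proof.
move=> [_ sol] xt; have := sol x t xt; rewrite /lap enorm_powR => ->.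
by congr (powR _ _); apply: eq_bigr => i _; rewrite mxE.
Qed.

Lemma cyl_inQ T t0 t1 x t : 0 < t0 -> t1 < T -> cyl (9 / 16) t0 t1 (x, t) ->
  inQ 1 T x t.
Proof.
move=> t00 t1T [/= xn]; rewrite in_itv/= => /andP[tt0 tt1].
split; first by rewrite enorm_lt// expr1n; apply: (le_lt_trans xn); lra.
by rewrite (lt_le_trans t00)//=; apply: le_lt_trans t1T.
Qed.

(** A single scale e serves all the moduli and keeps every shift of size less than e inside Q, so
    that the difference quotients make sense on the closed cylinder. *)
Lemma cyl_uniform T u t0 t1 d : C21 1 T u -> 0 < t0 -> t1 < T -> 0 < d ->
  exists2 e : R, 0 < e & forall x t x' t', cyl (9 / 16) t0 t1 (x, t) ->
    ball (x, t) e (x', t') ->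
    [/\ inQ 1 T x' t', forall i, `|dx u i x' t' - dx u i x t| < d,
      forall i, `|dxx u i i x' t' - dxx u i i x t| < d &
      `|dt u x' t' - dt u x t| < d].
Proof.
move=> cu t00 t1T d0; pose K := cyl (n := n) (9 / 16) t0 t1.
have cK : compact K by apply: cyl_compact; lra.
have KQ z : K z -> inQ 1 T z.1 z.2 by case: z => x t; exact: cyl_inQ.
pose near_K (f : 'rV[R]_n * R -> R) e d := forall z, K z ->
  forall z', ball z e z' -> `|f z' - f z| < d.
have unif (f : 'rV[R]_n * R -> R) c : (forall z, K z -> {for z, continuous f}) ->
    0 < c -> \forall e \near (0 : R)^'+, near_K f e c.
  by move=> cf c0; apply: compact_uniformly_continuous.
have c1 : \forall e \near (0 : R)^'+,
    forall i, near_K (fun z => dx u i z.1 z.2) e d.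
  apply: filter_forall => i; apply: unif => // -[x t] /KQ xt.
  by have [_ _ h _ _] := cu x t xt; exact: h.
have c2 : \forall e \near (0 : R)^'+,
    forall i, near_K (fun z => dxx u i i z.1 z.2) e d.
  apply: filter_forall => i; apply: unif => // -[x t] /KQ xt.
  by have [_ _ _ h _] := cu x t xt; exact: h.
have c3 : \forall e \near (0 : R)^'+, near_K (fun z => dt u z.1 z.2) e d.
  by apply: unif => // -[x t] /KQ xt; have [_ _ _ _ h] := cu x t xt; exact: h.
(* 9/16 + 1/4 < 1 keeps the shifted point in the unit ball; the next two moduli keep its time in (0,
   T). *)
have c4 : \forall e \near (0 : R)^'+, near_K (fun z => sqnorm z.1) e 4^-1.
  apply: unif; last by rewrite invr_gt0.
  move=> z _; apply: (@continuous_comp _ _ _ fst (@sqnorm R n)); first exact: cvg_fst.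
  exact: sqnorm_continuous.
have c5 : \forall e \near (0 : R)^'+, near_K snd e t0.
  by apply: unif => // z _; exact: cvg_snd.
have c6 : \forall e \near (0 : R)^'+, near_K snd e (T - t1).
  by apply: unif; [move=> z _; exact: cvg_snd|rewrite subr_gt0].
have c7 : \forall e \near (0 : R)^'+, 0 < e by exact: nbhs_right_gt.
have [e [[[e1 e2] [e3 e4]] [[e5 e6] e0]]] := @filter_ex _ (0 : R)^'+ _ _
  (filterI (filterI (filterI c1 c2) (filterI c3 c4)) (filterI (filterI c5 c6) c7)).
exists e => // x t x' t' xt xt'; split.
- have := e4 _ xt _ xt'; have := e5 _ xt _ xt'; have := e6 _ xt _ xt' => /=.
  case: xt => /= xn; rewrite in_itv/= => /andP[tt0 tt1].
  rewrite !ltr_norml => /andP[_ a6] /andP[a5 _] /andP[_ a4].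
  by split; [rewrite enorm_lt// expr1n; lra|apply/andP; split; lra].
- by move=> i; exact: (e1 i _ xt _ xt').
- by move=> i; exact: (e2 i _ xt _ xt').
- exact: (e3 _ xt _ xt').
Qed.

(* The discrete version of a (1 + |grad u|^2)^P - u_t: forward in space, backward
   in time, so that [0 < h] keeps the time argument below t. *)
Definition bernstein_quotient u (a P h : R) (z : 'rV[R]_n * R) : R :=
  a * powR (1 + \sum_(i < n) (h^-1 * (u (z.1 + h *: ebasis R i) z.2 - u z.1 z.2)) ^+ 2) P
  - h^-1 * (u z.1 z.2 - u z.1 (z.2 - h)).

Lemma quotient_continuous u a P h x t :
  {for (x, t), continuous (fun z => u z.1 z.2)} ->
  {for (x, t - h), continuous (fun z => u z.1 z.2)} ->
  (forall i, {for (x + h *: ebasis R i, t), continuous (fun z => u z.1 z.2)}) ->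
  {for (x, t), continuous (bernstein_quotient u a P h)}.
Proof.
move=> c0 ct ci; pose U (z : 'rV[R]_n * R) := u z.1 z.2.
have csub (f g : 'rV[R]_n * R -> R) : {for (x, t), continuous f} ->
    {for (x, t), continuous g} -> {for (x, t), continuous (fun z => h^-1 * (f z - g z))}.
  move=> cf cg; apply: continuousM; first exact: cst_continuous.
  exact: continuousB.
have cx i : {for (x, t), continuous (fun z : 'rV[R]_n * R => u (z.1 + h *: ebasis R i) z.2)}.
  have f1 : z.1 + h *: ebasis R i @[z --> (x, t)] --> x + h *: ebasis R i.
    by apply: cvgD; [exact: cvg_fst|exact: cvg_cst].
  exact: (@continuous2_cvg _ _ _ _ (nbhs (x, t)) _ (fun z => z.1 + h *: ebasis R i) snd u
    (x + h *: ebasis R i) t (ci i) f1 cvg_snd).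
have cth : {for (x, t), continuous (fun z : 'rV[R]_n * R => u z.1 (z.2 - h))}.
  have f2 : z.2 - h @[z --> (x, t)] --> t - h.
    by apply: cvgB; [exact: cvg_snd|exact: cvg_cst].
  exact: (@continuous2_cvg _ _ _ _ (nbhs (x, t)) _ fst (fun z => z.2 - h) u
    x (t - h) ct cvg_fst f2).
apply: continuousB; last exact: csub.
apply: continuousM; first exact: cst_continuous.
apply: (@continuous_comp _ _ _ _ (fun y : R => powR y P)).
  apply: continuousD; first exact: cst_continuous.
  apply: (@continuous_at_sum R _ n (fun i (z : 'rV[R]_n * R) => (h^-1 * (u (z.1 + h *: ebasis R i) z.2 - u z.1 z.2)) ^+ 2)) => i.
  by have c := csub _ _ (cx i) c0; exact: (continuousM c c).
apply: is_derive1_continuous; apply: is_derive1_powR.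
by rewrite ltr_pwDl// sumr_ge0// => i _; rewrite sqr_ge0.
Qed.

End unit_cylinder.

(** * Uniform bound of the difference quotients by the maximum principle *)

Section quotient_bound.
Set Implicit Arguments. Unset Strict Implicit. Unset Printing Implicit Defensive.
Local Open Scope classical_set_scope.
Local Open Scope ring_scope.
Context {R : realType} {n : nat}.
Implicit Types (x y : 'rV[R]_n) (t s r T : R) (u : 'rV[R]_n -> R -> R).

Lemma sum_sqr_close (q v : 'I_n -> R) (Q d : R) : d <= 1 ->
  (forall i, `|q i| <= Q) -> (forall i, `|v i - q i| <= d) ->
  `|\sum_(i < n) v i ^+ 2 - \sum_(i < n) q i ^+ 2| <= n%:R * (d * (2 * Q + 1)).
Proof.
move=> d1 qQ vq; rewrite -sumrB; apply: (le_trans (ler_norm_sum _ _ _)).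
rewrite mulr_natl -[leRHS](_ : \sum_(i < n) d * (2 * Q + 1) = _); last first.
  by rewrite sumr_const card_ord.
apply: ler_sum => i _.
have -> : v i ^+ 2 - q i ^+ 2 = (v i - q i) * ((v i - q i) + 2 * q i) by ring.
rewrite normrM; apply: ler_pM => //; apply: (le_trans (ler_normD _ _)).
by rewrite normrM (ger0_norm (ler0n _ _)); have := qQ i; have := vq i; lra.
Qed.

Lemma slope_error_le (v b : 'I_n -> R) (B : 'I_n -> 'I_n -> R) (w : 'I_n -> R) (Q e : R) :
  0 <= e -> (forall i, `|v i| <= Q) -> (forall i j, `|B i j - w j| <= e) ->
  (forall j, `|b j - w j| <= e) ->
  \sum_(i < n) \sum_(j < n) v i ^+ 2 * (B i j - b j) ^+ 2
    <= (n%:R * (Q * (2 * e))) ^+ 2.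
Proof.
move=> e0 vQ Bw bw.
have -> : (n%:R * (Q * (2 * e))) ^+ 2 =
    \sum_(i < n) \sum_(j < n) (Q ^+ 2 * (2 * e) ^+ 2).
  by rewrite !sumr_const card_ord -[RHS]mulr_natl -[_ *+ n]mulr_natl; ring.
apply: ler_sum => i _; apply: ler_sum => j _.
rewrite -!exprMn -[leLHS]real_normK ?num_real//.
have Q0 : 0 <= Q by apply: le_trans (vQ i).
have h : `|v i * (B i j - b j)| <= Q * (2 * e).
  rewrite normrM; apply: ler_pM => //.
  have -> : B i j - b j = (B i j - w j) - (b j - w j) by ring.
  by apply: (le_trans (ler_normB _ _)); have := Bw i j; have := bw j; lra.
by rewrite ler_sqr ?nnegrE// mulr_ge0// mulr_ge0.
Qed.

Lemma cyl_gradient_bounded T u t0 t1 : C21 1 T u -> 0 < t0 -> t0 < t1 -> t1 < T ->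
  exists2 Q : R, 0 <= Q & forall x t, cyl (9 / 16) t0 t1 (x, t) ->
    forall i, `|dx u i x t| <= Q.
Proof.
move=> cu t00 t01 t1T; pose K := cyl (R := R) (n := n) (9 / 16) t0 t1.
pose f (z : 'rV[R]_n * R) := \sum_(i < n) dx u i z.1 z.2 ^+ 2.
have [|||z0 _ fmax] := @compact_EVT_max _ R f K.
- exists (0, t0); split => /=; last by rewrite in_itv/= lexx ltW.
  by rewrite /sqnorm big1 ?divr_ge0// => i _; rewrite mxE expr0n.
- by apply: cyl_compact; lra.
- apply: continuous_in_subspaceT => -[x t]; rewrite inE => /(cyl_inQ t00 t1T) xt.
  have [_ _ cdx _ _] := cu x t xt.
  apply: (@continuous_at_sum R _ n (fun i (z : 'rV[R]_n * R) => dx u i z.1 z.2 ^+ 2)) => i.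
  exact: (continuousM (cdx i) (cdx i)).
have f0 z : 0 <= f z by apply: sumr_ge0 => i _; rewrite sqr_ge0.
exists (1 + f z0) => [|x t xt i]; first by rewrite addr_ge0.
have fxt : f (x, t) <= f z0 by apply: fmax; rewrite inE.
have dxf : dx u i x t ^+ 2 <= f (x, t).
  by rewrite /f (bigD1 i)//= lerDl; apply: sumr_ge0 => j _; rewrite sqr_ge0.
have h := le_trans dxf fxt.
rewrite -(@ler_sqr _ `|_|) ?nnegrE ?addr_ge0// real_normK ?num_real//.
by apply: (le_trans h); have := f0 z0; nra.
Qed.

(** The product on the left vanishes on the lateral and bottom faces, so a large positive maximum is
    attained away from them; only the top face remains possible. The number m is chosen before u,
    and e alone depends on u and on the cylinder. *)
Lemma quotient_bound (a p : R) : 2^-1 <= a -> a < 1 -> 2 < p ->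
  exists2 m : R, 1 <= m & forall T u t0 t1, classical_solution p 1 T u ->
    0 < t0 -> t0 < t1 -> t1 < T ->
    exists2 e : R, 0 < e & forall h, 0 < h -> h < e ->
      forall x t, cyl (9 / 16) t0 t1 (x, t) ->
      bernstein_quotient u a (p / 2) h (x, t) * (9 / 16 - sqnorm x) ^+ 2 * (t - t0)
        <= m ^+ 2 * (1 + (t1 - t0)).
Proof.
have quotientE u a' P h x t : bernstein_quotient u a' P h (x, t) =
  a' * powR (1 + \sum_(i < n) (h^-1 * (u (x + h *: ebasis R i) t - u x t)) ^+ 2) P
  - h^-1 * (u x t - u x (t - h)) by [].
have subrACA (z1 z2 z3 z4 : R) : z1 - z2 - (z3 - z4) = z1 - z3 - (z2 - z4) by ring.
move=> a2 a1 p2; pose P := p / 2; have P1 : 1 < P by rewrite /P; lra.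
have [m m1 Hm] := @touching_contradiction R n a P a2 a1 P1.
exists m => // T u t0 t1 sol t00 t01 t1T.
have cu : C21 1 T u by case: sol.
have [Q Q0 HQ] := cyl_gradient_bounded cu t00 t01 t1T.
have n0 : 0 <= n%:R :> R by [].
have n1 : 0 < n%:R + 1 :> R by rewrite ltr_wpDl.
(* Makes the drift mismatch, at most (n (Q + 1) 2 eps)^2, no larger than 1; Q + 1 bounds the space
   quotients. *)
pose eps := (2 * (n%:R + 1) * (Q + 1))^-1 : R.
have Q1 : 0 < Q + 1 by rewrite ltr_wpDl.
have eps0 : 0 < eps by rewrite invr_gt0 !mulr_gt0.
have epsE : (n%:R + 1) * ((Q + 1) * (2 * eps)) = 1.
  by rewrite /eps; field; rewrite !gt_eqF.
have eps1 : eps <= 1.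
  by rewrite invf_le1 ?mulr_gt0//; move: (n%:R : R) n0 Q0 => z; clear; nra.
have [d0 d00 Hslope] := @pow_sum_slope R n P Q eps P1 Q0 eps0.
(* (n + 1) d1 (2 Q + 1) = 1/2 keeps the two square sums within 1/2 of each other; it also bounds by
   1/2 the n + 1 errors made in the equation. *)
pose d1 := (2 * (n%:R + 1) * (2 * Q + 1))^-1 : R.
have Q21 : 0 < 2 * Q + 1 by rewrite ltr_wpDl// mulr_ge0.
have d10 : 0 < d1 by rewrite invr_gt0 !mulr_gt0.
have d1E : (n%:R + 1) * (d1 * (2 * Q + 1)) = 2^-1.
  by rewrite /d1; field; rewrite !gt_eqF.
have d1n : (n%:R + 1) * d1 <= 2^-1.
  rewrite -d1E ler_pM2l// ler_peMr ?(ltW d10)//; move: Q0; clear; lra.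
pose d := Num.min d0 d1.
have dpos : 0 < d by rewrite lt_min d00.
have dd0 : d <= d0 by rewrite ge_min lexx.
have dd1 : d <= d1 by rewrite ge_min lexx orbT.
have dn : (n%:R + 1) * d <= 2^-1 by apply: le_trans d1n; rewrite ler_pM2l.
have d2 : d <= 2^-1.
  by apply: le_trans dn; rewrite ler_peMl ?(ltW dpos)// lerDr.
have [e e0 He] := cyl_uniform cu t00 t1T dpos.
exists e => // h h0 he.
pose e_ i := ebasis R i : 'rV[R]_n.
pose K := cyl (R := R) (n := n) (9 / 16) t0 t1.
have hn : `|h| < e by rewrite gtr0_norm.
have inQx x t i s : K (x, t) -> `|s| < e -> inQ 1 T (x + s *: e_ i) t.
  by move=> xt se; have [] := He _ _ _ _ xt (ball_line x t i se).
have inQt x t s : K (x, t) -> `|s| < e -> inQ 1 T x (t - s).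
  move=> xt se; have [] := He x t x (t - s) xt _ => //.
  by apply: ball_time; rewrite addrC addKr normrN.
have inQ0 x t : K (x, t) -> inQ 1 T x t by exact: cyl_inQ.
pose Z (z : 'rV[R]_n * R) := bernstein_quotient u a P h z * (9 / 16 - sqnorm z.1) ^+ 2 * (z.2 - t0).
have [|||z0 z0K Zmax] := @compact_EVT_max _ R Z K.
- exists (0, t0); split => /=; last by rewrite in_itv/= lexx ltW.
  by rewrite /sqnorm big1 ?divr_ge0// => i _; rewrite mxE expr0n.
- by apply: cyl_compact; lra.
- apply: continuous_in_subspaceT => -[x t]; rewrite inE => xt.
  have cQ : {for (x, t), continuous (bernstein_quotient u a P h)}.
    apply: quotient_continuous => [||i].
    + by have [_ c _ _ _] := cu _ _ (inQ0 _ _ xt).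
    + by have [_ c _ _ _] := cu _ _ (inQt _ _ _ xt hn).
    + by have [_ c _ _ _] := cu _ _ (inQx _ _ i _ xt hn).
  have cphi : {for (x, t), continuous (fun z : 'rV[R]_n * R => 9 / 16 - sqnorm z.1)}.
    apply: continuousB; first exact: cst_continuous.
    apply: (@continuous_comp _ _ _ fst (@sqnorm R n)); first exact: cvg_fst.
    exact: sqnorm_continuous.
  have ct : {for (x, t), continuous (fun z : 'rV[R]_n * R => z.2 - t0)}.
    by apply: continuousB; [exact: cvg_snd|exact: cst_continuous].
  exact: (continuousM (continuousM cQ (continuousM cphi cphi)) ct).
move=> x' t' xt'.
(* The threshold has two summands because k has to exceed both m^2, for [mth], and m^2 (t - t0), for
   [my]. *)
have [kle|kgt] := leP (Z z0) (m ^+ 2 * (1 + (t1 - t0))).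
  by apply: le_trans kle; have := Zmax (x', t'); rewrite inE => /(_ xt').
exfalso; case: z0 z0K Zmax kgt => x t; rewrite inE => xt Zmax kgt {x' t' xt'}.
set k := Z (x, t) in kgt Zmax.
have {}Zmax x' t' : K (x', t') -> Z (x', t') <= k.
  by move=> xt'; apply: Zmax; rewrite inE.
have := xt => -[/= xn]; rewrite in_itv/= => /andP[t0t tt1].
have m20 : 0 < m ^+ 2 by rewrite exprn_gt0// (lt_le_trans _ m1).
have T0 : 0 < t1 - t0 by rewrite subr_gt0.
have k0 : 0 < k by apply: lt_trans kgt; rewrite mulr_gt0// addr_gt0.
pose f0 := 9 / 16 - sqnorm x.
have f00 : 0 < f0.
  rewrite lt_neqAle subr_ge0 xn andbT; apply/eqP => f00; move: k0.
  by rewrite /k /Z /= -/f0 -f00 expr0n mulr0 mul0r ltxx.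
have tt0 : t0 < t.
  rewrite lt_neqAle t0t andbT; apply/eqP => tt; move: k0.
  by rewrite /k /Z /= -tt subrr mulr0 ltxx.
pose th := (t - t0)^-1; pose y := f0^-1.
have tt00 : 0 < t - t0 by rewrite subr_gt0.
have th0 : 0 < th by rewrite invr_gt0.
have y1 : 1 <= y.
  rewrite /y invf_ge1//; have := sqnorm_ge0 x; rewrite /f0; clear; lra.
have y0 : 0 < y by rewrite invr_gt0.
pose psi := k * y ^+ 2 * th.
have Ezt : bernstein_quotient u a P h (x, t) = psi.
  rewrite /psi /k /Z /= -/f0 /y /th; field.
  by rewrite !gt_eqF.
have psiE : psi = k * th * y ^+ 2 by rewrite /psi; ring.
have my : m ^+ 2 * y ^+ 2 <= psi.
  rewrite psiE ler_pM2r ?exprn_gt0//.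
  rewrite /th ler_pdivlMr//; apply: ltW; apply: le_lt_trans kgt.
  by rewrite ler_pM2l//; move: tt1; clear; lra.
have mth : m ^+ 2 * th <= psi.
  rewrite /psi ler_pM2r//; apply: ltW; apply: (@lt_le_trans _ _ k).
    apply: le_lt_trans kgt; rewrite ler_peMr ?(ltW m20)// lerDl ltW//.
  rewrite ler_peMr ?(ltW k0)//; apply: (le_trans y1).
  by rewrite expr2 ler_peMr// ltW.
pose q i := dx u i x t.
pose v i := h^-1 * (u (x + h *: e_ i) t - u x t).
pose D := h^-1 * (u x t - u x (t - h)).
(* W i j is the j-th derivative of v i: the shift in direction i is applied to [dx u j], so its
   further j-th derivative involves [dxx u j j] only. On the diagonal W i i is close to
   [dxx u i i]. *)
pose W i j := h^-1 * (dx u j (x + h *: e_ i) t - dx u j x t).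
have hV : h^-1 * h = 1 by rewrite mulVf ?gt_eqF.
have vq i : `|v i - q i| <= d.
  have [|c c0 E] := @mean_value R (fun s => u (x + s *: e_ i) t)
    (fun s => dx u i (x + s *: e_ i) t) 0 h h0.
    move=> s sh; apply: (is_derive_dx cu); apply: inQx => //.
    by apply: le_lt_trans he; rewrite ger0_norm; case/andP: sh.
  have ce : `|c| < e.
    by apply: lt_trans he; case/andP: c0 => c1 c2; rewrite gtr0_norm.
  move: E; rewrite scale0r addr0 subr0 /v => ->.
  have [_ H _ _] := He _ _ _ _ xt (ball_line x t i ce).
  by rewrite mulrCA hV mulr1; apply: ltW; exact: H.
have WX i : `|W i i - dxx u i i x t| <= d.
  have [|c c0 E] := @mean_value R (fun s => dx u i (x + s *: e_ i) t)
    (fun s => dxx u i i (x + s *: e_ i) t) 0 h h0.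
    move=> s sh; apply: (is_derive_dxx _ cu); apply: inQx => //.
    by apply: le_lt_trans he; rewrite ger0_norm; case/andP: sh.
  have ce : `|c| < e.
    by apply: lt_trans he; case/andP: c0 => c1 c2; rewrite gtr0_norm.
  move: E; rewrite scale0r addr0 subr0 /W => ->.
  have [_ _ H _] := He _ _ _ _ xt (ball_line x t i ce).
  by rewrite mulrCA hV mulr1; apply: ltW; exact: H.
have DX : `|D - dt u x t| <= d.
  have th' : t - h < t by rewrite gtrBl.
  have [|c c0 E] := @mean_value R (u x) (dt u x) (t - h) t th'.
    move=> s sh; apply: (is_derive_dt cu); rewrite -[s](subKr t).
    apply: inQt => //; apply: le_lt_trans he; move: sh; rewrite ler_norml.
    by move: h0; clear; lra.
  have ct : `|c - t| < e.
    by apply: lt_trans he; move: c0 h0; rewrite ltr_norml; clear; lra.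
  have [_ _ _ H] := He _ _ _ _ xt (ball_time x ct).
  move: E; rewrite subKr /D => ->.
  by rewrite mulrCA hV mulr1; apply: ltW; exact: H.
have qQ i : `|q i| <= Q by exact: HQ.
have HB i : exists2 Bi : 'I_n -> R,
    powR (\sum_(j < n) dx u j (x + h *: e_ i) t ^+ 2) P
        - powR (\sum_(j < n) q j ^+ 2) P
      = \sum_(j < n) Bi j * (dx u j (x + h *: e_ i) t - q j) &
    forall j, `|Bi j - 2 * P * powR (\sum_(j < n) q j ^+ 2) (P - 1) * q j| <= eps.
  apply: Hslope => // j.
  have [_ H _ _] := He _ _ _ _ xt (ball_line x t i hn).
  by apply: le_trans dd0; apply: ltW; exact: H.
pose B i := s2val (cid2 (HB i)).
have HB1 i := s2valP (cid2 (HB i)); have HB2 i := s2valP' (cid2 (HB i)).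
(* The same linearisation for the backward time shift. Here the shifted point is the earlier one,
   and the two resulting sign changes cancel in [ED]. *)
have [b Hb1 Hb2] : exists2 b : 'I_n -> R,
    powR (\sum_(j < n) dx u j x (t - h) ^+ 2) P - powR (\sum_(j < n) q j ^+ 2) P
      = \sum_(j < n) b j * (dx u j x (t - h) - q j) &
    forall j, `|b j - 2 * P * powR (\sum_(j < n) q j ^+ 2) (P - 1) * q j| <= eps.
  apply: Hslope => // j.
  have th' : `|t - h - t| < e by rewrite addrAC subrr sub0r normrN.
  have [_ H _ _] := He _ _ _ _ xt (ball_time x th').
  by apply: le_trans dd0; apply: ltW; exact: H.
pose F := a * P * powR (1 + \sum_(i < n) v i ^+ 2) (P - 1).
have a0 : 0 <= a by apply: le_trans a2; rewrite invr_ge0.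
have touch x' t' : K (x', t') -> 0 < 9 / 16 - sqnorm x' -> t0 < t' ->
    bernstein_quotient u a P h (x', t') <= k * (9 / 16 - sqnorm x')^-1 ^+ 2 * (t' - t0)^-1.
  move=> xt' f'0 tt'; rewrite exprVn ler_pdivlMr ?subr_gt0//.
  by rewrite ler_pdivlMr ?exprn_gt0// mulrAC; exact: Zmax.
have Hspace j : h^-1 * (dx u j x t - dx u j x (t - h))
      = 2 * F * \sum_(i < n) v i * W i j - 4 * psi * y * x ord0 j /\
    2 * F * (\sum_(i < n) W i j ^+ 2 + \sum_(i < n) v i *
      (h^-1 * (dxx u j j (x + h *: e_ i) t - dxx u j j x t)))
      - h^-1 * (dxx u j j x t - dxx u j j x (t - h))
     <= psi * (24 * y ^+ 2 * x ord0 j ^+ 2 + 4 * y).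
  pose f s := f0 - (2 * x ord0 j * s + s ^+ 2).
  pose f1 s := - (2 * x ord0 j) + s * (- 2).
  have fE s : f s = 9 / 16 - sqnorm (x + s *: e_ j).
    by rewrite sqnorm_line /f /f0; ring.
  have f'E s : is_derive (s : R) 1 f (f1 s).
    have df := is_derive1B (is_derive_cst f0 s 1)
      (is_derive1D (is_derive1Z (2 * x ord0 j) (is_derive_id s 1))
        (is_derive1X2 (is_derive_id s 1))).
    by apply: (is_derive_eq df); rewrite /f1 /=; ring.
  have f0E : f 0 = f0 by rewrite /f mulr0 expr0n/= addr0 subr0.
  (* Positivity of f along the line says that the line is still in the closed cylinder, where
     maximality applies. *)
  have : \forall s \near (0 : R), 0 < f s.
    by apply: (cvgr_gt (f 0) (is_derive1_continuous (f'E 0))); rewrite f0E.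
  move=> /nbhs_ballP[e1 /= e10 fpos].
  have {}fpos s : `|s| < e1 -> 0 < f s.
    by move=> se; apply: fpos; rewrite /ball/= sub0r normrN.
  have Ks s : `|s| < e1 -> K (x + s *: e_ j, t).
    move=> /fpos; rewrite fE subr_gt0 => /ltW se; split => //=.
    by rewrite in_itv/= t0t.
  have e10' : `|0 : R| < e1 by rewrite normr0.
  have E1 s : a * powR (1 + \sum_(i < n) (h^-1 * (u (x + h *: e_ i + s *: e_ j) t
          - u (x + s *: e_ j) t)) ^+ 2) P
        - h^-1 * (u (x + s *: e_ j) t - u (x + s *: e_ j) (t - h))
      = bernstein_quotient u a P h (x + s *: e_ j, t).
    rewrite quotientE; have -> // : \sum_(i < n)
        (h^-1 * (u (x + h *: e_ i + s *: e_ j) t - u (x + s *: e_ j) t)) ^+ 2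
      = \sum_(i < n) (h^-1 * (u (x + s *: e_ j + h *: e_ i) t - u (x + s *: e_ j) t)) ^+ 2.
    by apply: eq_bigr => i _; rewrite addrAC.
  have [] := @space_touching R n
    (fun i s => h^-1 * (u (x + h *: e_ i + s *: e_ j) t - u (x + s *: e_ j) t))
    (fun i s => h^-1 * (dx u j (x + h *: e_ i + s *: e_ j) t - dx u j (x + s *: e_ j) t))
    (fun i => h^-1 * (dxx u j j (x + h *: e_ i) t - dxx u j j x t))
    (fun s => h^-1 * (u (x + s *: e_ j) t - u (x + s *: e_ j) (t - h)))
    (fun s => h^-1 * (dx u j (x + s *: e_ j) t - dx u j (x + s *: e_ j) (t - h)))
    f f1 (h^-1 * (dxx u j j x t - dxx u j j x (t - h))) (- 2) a P (k * th) e1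
    v (W^~ j) _ _ e10 a0 P1.
  - by move=> i; rewrite scale0r !addr0.
  - by move=> i; rewrite scale0r !addr0.
  - move=> s i se; apply: is_derive1Z; apply: is_derive1B; apply: (is_derive_dx cu).
      by rewrite addrAC; apply: inQx => //; exact: Ks.
    by apply: inQ0; exact: Ks.
  - move=> s se; apply: is_derive1Z; apply: is_derive1B; apply: (is_derive_dx cu).
      by apply: inQ0; exact: Ks.
    by apply: inQt => //; exact: Ks.
  - move=> i; apply: is_derive1Z; apply: is_derive1B.
      have := @is_derive_dxx R n 1 T u (x + h *: e_ i) t j j 0 cu.
      by rewrite scale0r addr0; apply; exact: inQx.
    have := @is_derive_dxx R n 1 T u x t j j 0 cu.
    by rewrite scale0r addr0; apply; exact: inQ0.
  - apply: is_derive1Z; apply: is_derive1B.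
      have := @is_derive_dxx R n 1 T u x t j j 0 cu.
      by rewrite scale0r addr0; apply; exact: inQ0.
    have := @is_derive_dxx R n 1 T u x (t - h) j j 0 cu.
    by rewrite scale0r addr0; apply; exact: inQt.
  - exact: is_derive1_lin.
  - exact: fpos.
  - move=> s se; rewrite (E1 s) (E1 0) f0E scale0r addr0 Ezt psiE -/y subrr subr_le0.
    rewrite mulrAC fE; apply: (touch _ _ (Ks _ se) _ tt0).
    by rewrite -fE; exact: fpos.
  rewrite f0E !scale0r !addr0 -/F => -> H2.
  have f10 : f1 0 = - (2 * x ord0 j) by rewrite /f1 mul0r addr0.
  split; first by rewrite f10 psiE -/y; ring.
  by apply: (le_trans H2); rewrite f10 psiE -/y le_eqVlt; apply/orP; left; apply/eqP; ring.
have Htime : h^-1 * (dt u x t - dt u x (t - h)) <=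
    2 * F * \sum_(i < n) v i * (h^-1 * (dt u (x + h *: e_ i) t - dt u x t)) + psi * th.
  have := @time_touching R n (fun i s => h^-1 * (u (x + h *: e_ i) s - u x s))
    (fun i => h^-1 * (dt u (x + h *: e_ i) t - dt u x t))
    (fun s => h^-1 * (u x s - u x (s - h)))
    (h^-1 * (dt u x t - dt u x (t - h))) a P (k * y ^+ 2) t0 t tt0 P1.
  have -> : psi * th = k * y ^+ 2 * (t - t0)^-1 ^+ 2 by rewrite -/th expr2 mulrA.
  apply.
  - move=> i; apply: is_derive1Z; apply: is_derive1B; apply: (is_derive_dt cu).
      exact: inQx.
    exact: inQ0.
  - apply: is_derive1Z; apply: is_derive1B; first by apply: (is_derive_dt cu); exact: inQ0.
    have D1 := is_derive_dt cu (inQt _ _ _ xt hn).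
    have D2 := is_derive1B (is_derive_id t 1) (is_derive_cst h t 1).
    have D3 := is_derive1_compose (f := u x) (g := fun s => s - h) D1 D2.
    by apply: (is_derive_eq D3); rewrite subr0 mulr1.
  (* Radius t - t0 keeps s above t0, and s < t keeps (x, s) in the cylinder even when t = t1. *)
  rewrite near_withinE; apply/nbhs_ballP; exists (t - t0) => //= s.
  rewrite /ball/= ltr_norml => /andP[s1 s2] st.
  have t0s : t0 < s by move: s2; clear; lra.
  have Kst : K (x, s).
    by split => //=; rewrite in_itv/= ltW//= (le_trans (ltW st)).
  have E0 : a * powR (1 + \sum_(i < n) (h^-1 * (u (x + h *: e_ i) t - u x t)) ^+ 2) P
        - h^-1 * (u x t - u x (t - h)) = psi by rewrite -Ezt quotientE.
  rewrite E0 -/th -/psi subrr subr_le0.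
  exact: (touch _ _ Kst f00 t0s).
have sumx : \sum_(j < n) x ord0 j ^+ 2 <= 1.
  by rewrite -/(sqnorm x); apply: (le_trans xn); clear; lra.
have psi0 : 0 <= psi by apply: le_trans my; rewrite mulr_ge0// sqr_ge0.
have P0 : 0 <= P by exact: ltW (lt_trans ltr01 P1).
have F0 : 0 <= F.
  by apply: mulr_ge0; [exact: (mulr_ge0 a0 P0)|exact: powR_ge0].
have Halg := @touching_algebra R n F psi y th v
  (fun i => h^-1 * (dt u (x + h *: e_ i) t - dt u x t))
  (fun j => h^-1 * (dx u j x t - dx u j x (t - h))) (x ord0) b W
  (fun i j => h^-1 * (dxx u j j (x + h *: e_ i) t - dxx u j j x t)) B
  (fun j => h^-1 * (dxx u j j x t - dxx u j j x (t - h)))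
  (h^-1 * (dt u x t - dt u x (t - h))) F0 psi0 y1 sumx
  (fun j => (Hspace j).1) (fun j => (Hspace j).2) Htime.
have p0 := pde sol (inQ0 _ _ xt).
have Ev i : h^-1 * (dt u (x + h *: e_ i) t - dt u x t)
    - \sum_(j < n) h^-1 * (dxx u j j (x + h *: e_ i) t - dxx u j j x t)
    = \sum_(j < n) B i j * W i j.
  have p1 := pde sol (inQx _ _ i _ xt hn).
  rewrite -mulr_sumr -mulrBr sumrB.
  rewrite (subrACA (dt u (x + h *: e_ i) t)).
  by rewrite p1 p0 HB1 mulr_sumr; apply: eq_bigr => j _; rewrite mulrCA.
have ED : h^-1 * (dt u x t - dt u x (t - h))
    - \sum_(j < n) h^-1 * (dxx u j j x t - dxx u j j x (t - h))
    = \sum_(j < n) b j * (h^-1 * (dx u j x t - dx u j x (t - h))).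
  have p1 := pde sol (inQt _ _ _ xt hn).
  rewrite -mulr_sumr -mulrBr sumrB.
  rewrite (subrACA (dt u x t)).
  rewrite p1 p0 -opprB Hb1 mulrN mulr_sumr -sumrN; apply: eq_bigr => j _.
  by rewrite /q; ring.
have n_n1 : n%:R <= n%:R + 1 :> R by rewrite lerDl.
apply: (@Hm q v b W B D psi y th y1 (ltW th0) my mth _ _ _ _ _ (Halg Ev ED)).
- have d1' : d <= 1 by apply: (le_trans d2); rewrite invf_le1// ler1n.
  apply: (le_trans (sum_sqr_close d1' qQ vq)); rewrite -d1E.
  apply: ler_pM => //; first by rewrite mulr_ge0// ltW.
  by rewrite ler_wpM2r// ltW.
- by rewrite -Ezt quotientE.
- have -> : \sum_(i < n) W i i - (D - powR (\sum_(i < n) q i ^+ 2) P) =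
      \sum_(i < n) (W i i - dxx u i i x t) - (D - dt u x t).
    by rewrite sumrB; move: p0; rewrite -/P => <-; ring.
  apply: (le_trans (ler_normB _ _)).
  have s1 : `|\sum_(i < n) (W i i - dxx u i i x t)| <= n%:R * d.
    apply: (le_trans (ler_norm_sum _ _ _)).
    apply: (le_trans (ler_sum _ (fun i _ => WX i))).
    by rewrite sumr_const card_ord -[leLHS]mulr_natl.
  by move: s1 DX dn; clear; lra.
- by move=> j; apply: le_trans eps1; exact: Hb2.
have vQ i : `|v i| <= Q + 1.
  have := ler_normD (v i - q i) (q i); rewrite subrK.
  by move: (vq i) (qQ i) d2; clear; lra.
apply: (le_trans (slope_error_le (ltW eps0) vQ HB2 Hb2)).
have z0 : 0 <= (Q + 1) * (2 * eps) by rewrite !mulr_ge0// ltW.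
have z1 : n%:R * ((Q + 1) * (2 * eps)) <= 1.
  by have := ler_wpM2r z0 n_n1; move: epsE; clear; lra.
by apply: exprn_ile1 => //; rewrite mulr_ge0.
Qed.

End quotient_bound.

(** * The limit of the difference quotients *)

Section local_estimate.
Set Implicit Arguments. Unset Strict Implicit. Unset Printing Implicit Defensive.
Local Open Scope classical_set_scope.
Local Open Scope ring_scope.
Context {R : realType} {n : nat}.
Implicit Types (x y : 'rV[R]_n) (t s r T : R) (u : 'rV[R]_n -> R -> R).

Lemma difference_quotient_cvg (g : R -> R) (d : R) : is_derive (0 : R) 1 g d ->
  h^-1 * (g h - g 0) @[h --> 0^'+] --> d.
Proof.
move=> [dg gE]; apply: cvg_dnbhs_at_right.
have cv : h^-1 *: (g (h *: 1 + 0) - g 0) @[h --> 0^'] --> d by rewrite -gE; exact: dg.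
rewrite (_ : (fun h => _) = (fun h : R => h^-1 *: (g (h *: 1 + 0) - g 0)))//.
by apply/funext => h; rewrite addr0 [h *: 1]mulr1.
Qed.

Lemma cvg_finsum (X : Type) (F : set_system X) m (f : 'I_m -> X -> R) (l : 'I_m -> R) :
  Filter F -> (forall i, f i z @[z --> F] --> l i) ->
  \sum_(i < m) f i z @[z --> F] --> \sum_(i < m) l i.
Proof.
move=> FF fl; have -> : (fun z => \sum_(i < m) f i z) = \sum_(i < m) f i.
  by apply/funext => y; rewrite fct_sumE.
apply: (big_ind2 (fun (g : X -> R) k => g z @[z --> F] --> k)) => //.
- exact: cvg_cst.
- by move=> g1 k1 g2 k2 c1 c2; exact: cvgD.
Qed.

Lemma quotient_cvg T u a P x t : C21 1 T u -> inQ 1 T x t ->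
  bernstein_quotient u a P h (x, t) @[h --> 0^'+] -->
    a * powR (1 + \sum_(i < n) dx u i x t ^+ 2) P - dt u x t.
Proof.
move=> cu xt; have v0 i : x + 0 *: ebasis R i = x by rewrite scale0r addr0.
have cv i : h^-1 * (u (x + h *: ebasis R i) t - u x t) @[h --> 0^'+] --> dx u i x t.
  have := @is_derive_dx R n 1 T u x t i 0 cu.
  rewrite v0 => /(_ xt) /difference_quotient_cvg.
  by rewrite v0.
have cD : h^-1 * (u x t - u x (t - h)) @[h --> 0^'+] --> dt u x t.
  have D1 := is_derive_dt cu xt.
  have D2 := is_derive1B (is_derive_cst t (0 : R) 1) (is_derive_id (0 : R) 1).
  have D3 : is_derive (0 : R) 1 (fun s => u x (t - s)) (dt u x t * (0 - 1)).
    by apply: (@is_derive1_compose _ (u x) (fun s => t - s)) => //; rewrite subr0.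
  have -> : (fun h => h^-1 * (u x t - u x (t - h)))
      = - (fun h => h^-1 * (u x (t - h) - u x (t - 0))).
    by apply/funext => h; rewrite opprfctE -mulrN opprB subr0.
  have -> : dt u x t = - (dt u x t * (0 - 1)) by ring.
  have D4 := difference_quotient_cvg D3.
  by apply: cvgN; exact: D4.
apply: cvgB => //; apply: cvgMr.
pose S := 1 + \sum_(i < n) dx u i x t ^+ 2.
have cS : {for S, continuous (fun z => powR z P)}.
  apply: is_derive1_continuous; apply: is_derive1_powR.
  by rewrite ltr_pwDl// sumr_ge0// => i _; rewrite sqr_ge0.
apply: (@continuous_cvg _ _ _ _ _ _ (fun z => powR z P)) => //.
apply: cvgD; first exact: cvg_cst.
by apply: cvg_finsum => i; exact: (cvgM (cv i) (cv i)).
Qed.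

Lemma unit_estimate (a p : R) : 2^-1 <= a -> a < 1 -> 2 < p ->
  exists2 C : R, 0 < C & forall T u x t, classical_solution p 1 T u ->
    enorm x < 2^-1 -> 0 < t -> t < T ->
    a * powR (enorm (grad u x t)) p - dt u x t <= C * (1 + t^-1).
Proof.
move=> a2 a1 p2; have [m m1 Hm] := @quotient_bound R n a p a2 a1 p2.
have m0 : 0 < m ^+ 2 by rewrite exprn_gt0// (lt_le_trans _ m1).
(* The cylinder has times from t/2 to t. For |x| < 1/2 the weight is at least (9/16 - 1/4)^2 t/2 =
   25 t/512, and 512/25 < 21. *)
exists (m ^+ 2 * 21); first by rewrite mulr_gt0.
move=> T u x t sol; rewrite enorm_lt ?invr_gt0// => xn t0 tT.
have t20 : 0 < t / 2 by rewrite divr_gt0.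
have t2t : t / 2 < t by rewrite ltr_pdivrMr// mulr_natr mulr2n ltrDl.
have [e e0 He] := Hm T u (t / 2) t sol t20 t2t tT.
have xt : cyl (9 / 16) (t / 2) t (x, t).
  split => /=; first by move: xn; rewrite exprVn; clear; lra.
  by rewrite in_itv/= lexx (ltW t2t).
have Q := cyl_inQ t20 tT xt.
have cu : C21 1 T u by case: sol.
set s := \sum_(i < n) dx u i x t ^+ 2.
have s0 : 0 <= s by apply: sumr_ge0 => i _; rewrite sqr_ge0.
pose L := a * powR (1 + s) (p / 2) - dt u x t.
pose w := (9 / 16 - sqnorm x) ^+ 2 * (t - t / 2).
have HL : L * w <= m ^+ 2 * (1 + (t - t / 2)).
  have cL : bernstein_quotient u a (p / 2) h (x, t) * w @[h --> 0^'+] --> L * w.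
    have qc := @quotient_cvg T u a (p / 2) x t cu Q.
    exact: (cvgM qc (cvg_cst w)).
  have r0 : \forall h \near (0 : R)^'+, 0 < h by exact: nbhs_right_gt.
  have re : \forall h \near (0 : R)^'+, h < e by exact: nbhs_right_lt.
  apply: (ler_cvg_to cL (cvg_cst _)).
  by apply: filterS2 r0 re => h h0 he; rewrite /w mulrA; exact: He.
have GE : powR (enorm (grad u x t)) p = powR s (p / 2).
  by rewrite enorm_powR; congr powR; apply: eq_bigr => i _; rewrite mxE.
have GL : a * powR (enorm (grad u x t)) p - dt u x t <= L.
  rewrite GE lerB// ler_wpM2l//; first by apply: le_trans a2; rewrite invr_ge0.
  apply: ge0_ler_powR; rewrite ?nnegrE ?addr_ge0 ?lerDr//.
  by rewrite divr_ge0// ltW// (lt_trans _ p2).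
apply: (le_trans GL).
have [L0|L0] := leP L 0.
  apply: (le_trans L0); rewrite mulr_ge0 ?addr_ge0 ?invr_ge0 ?ltW// mulr_gt0//.
have wl : 25 / 256 * (t / 2) <= w.
  rewrite /w; have -> : t - t / 2 = t / 2 by field.
  rewrite ler_pM2r//; move: xn (sqnorm_ge0 x); rewrite exprVn.
  by move: (sqnorm x); clear; move=> z *; nra.
have h1 : L * (25 / 256 * (t / 2)) <= m ^+ 2 * (1 + t / 2).
  apply: (@le_trans _ _ (L * w)); first by rewrite ler_pM2l.
  by move: HL; have -> : t - t / 2 = t / 2 by field.
rewrite -(ler_pM2r t0); have -> : m ^+ 2 * 21 * (1 + t^-1) * t = m ^+ 2 * 21 * (t + 1).
  by field; rewrite gt_eqF.
by move: h1 m0 t0; move: (m ^+ 2); clear; move=> z *; nra.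
Qed.

Lemma derivable_lineE (V : normedModType R) (f : V -> R) (z v : V) :
  (derivable f z v <-> derivable (fun s : R => f (z + s *: v)) 0 1) /\
  'D_v f z = 'D_1 (fun s : R => f (z + s *: v)) 0.
Proof.
have E : (fun h : R => h^-1 *: (((fun t => f (z + t *: v)) \o shift 0) (h *: 1)
            - f (z + 0 *: v)))
         = (fun h => h^-1 *: ((f \o shift z) (h *: v) - f z)).
  by apply/funext => h /=; rewrite addr0 [h *: 1]mulr1 scale0r addr0 [z + _]addrC.
by split; [rewrite /derivable E|rewrite /derive E].
Qed.

(* The second conclusion needs no differentiability: 'D takes the junk value 0 on
   both sides at once. *)
Lemma derive_scale (V : normedModType R) (f : V -> R) (c k : R) (z v : V) :
  c != 0 -> k != 0 ->
  (derivable f (k *: z) v -> derivable (fun y : V => c * f (k *: y)) z v) /\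
  'D_v (fun y : V => c * f (k *: y)) z = c * k * 'D_v f (k *: z).
Proof.
move=> c0 k0.
have pos (g : V -> R) (c' k' : R) (z' : V) : derivable g (k' *: z') v ->
    is_derive z' v (fun y : V => c' * g (k' *: y)) (c' * k' * 'D_v g (k' *: z')).
  move=> dg; have [[dl _] gE] := derivable_lineE g (k' *: z') v.
  have [[_ dl'] gE'] := derivable_lineE (fun y : V => c' * g (k' *: y)) z' v.
  have D1 : is_derive (k' * 0) 1 (fun s : R => g (k' *: z' + s *: v))
      ('D_v g (k' *: z')) by rewrite mulr0 gE; exact: (derivableP (dl dg)).
  have D2 := is_derive1Z c' (@is_derive1_compose _ (fun s : R => g (k' *: z' + s *: v))
      (fun s => k' * s) 0 _ _ D1 (is_derive1Z k' (is_derive_id (0 : R) 1))).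
  have E : (fun s : R => c' * g (k' *: z' + (k' * s) *: v))
      = (fun s => c' * g (k' *: (z' + s *: v))).
    by apply/funext => s; rewrite scalerDr scalerA.
  have := D2; rewrite E => -[d1 d2].
  apply: DeriveDef; first exact: dl'.
  by rewrite gE' d2; ring.
split; first by move=> /(pos _ c)[].
have [/(pos _ c)[_ ->]//|nd] := pselect (derivable f (k *: z) v).
have nd' : ~ derivable (fun y : V => c * f (k *: y)) z v.
  move=> d; apply: nd.
  have := pos (fun y : V => c * f (k *: y)) c^-1 k^-1 (k *: z).
  rewrite scalerA mulVf// scale1r => /(_ d)[+ _].
  have -> // : (fun y : V => c^-1 * (c * f (k *: (k^-1 *: y)))) = f.
  by apply/funext => y; rewrite mulrA mulVf// mul1r scalerA mulfV// scale1r.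
by rewrite /derive (dvgP nd) (dvgP nd') mulr0.
Qed.

End local_estimate.

(** * Rescaling *)

Section rescaling.
Set Implicit Arguments. Unset Strict Implicit. Unset Printing Implicit Defensive.
Local Open Scope classical_set_scope.
Local Open Scope ring_scope.
Context {R : realType} {n : nat}.
Implicit Types (x y : 'rV[R]_n) (t s r T c : R) (u : 'rV[R]_n -> R -> R).

Lemma enormZ c x : 0 <= c -> enorm (c *: x) = c * enorm x.
Proof.
move=> c0; rewrite /enorm -[c in RHS]ger0_norm// -sqrtr_sqr -sqrtrM ?sqr_ge0//.
by congr Num.sqrt; rewrite mulr_sumr; apply: eq_bigr => i _; rewrite mxE exprMn.
Qed.

Definition rescale c r u y t : R := c * u (r *: y) (r ^+ 2 * t).

(** Valid at every point, also outside the cylinder: it has to be an identity of functions in order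
    to be rewritten under the second derivative. *)
Lemma dx_rescale c r u i y t : c != 0 -> r != 0 ->
  dx (rescale c r u) i y t = c * r * dx u i (r *: y) (r ^+ 2 * t).
Proof.
by move=> c0 r0; case: (derive_scale (fun z => u z (r ^+ 2 * t)) y (ebasis R i) c0 r0).
Qed.

Lemma dxx_rescale c r u i j y t : c != 0 -> r != 0 ->
  dxx (rescale c r u) i j y t = c * r * r * dxx u i j (r *: y) (r ^+ 2 * t).
Proof.
move=> c0 r0; rewrite /dxx.
have -> : (fun z => dx (rescale c r u) i z t)
    = (fun z => c * r * dx u i (r *: z) (r ^+ 2 * t)).
  by apply/funext => z; rewrite dx_rescale.
have cr0 : c * r != 0 by rewrite mulf_neq0.
by case: (derive_scale (fun z => dx u i z (r ^+ 2 * t)) y (ebasis R j) cr0 r0).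
Qed.

Lemma dt_rescale c r u y t : c != 0 -> r != 0 ->
  dt (rescale c r u) y t = c * r ^+ 2 * dt u (r *: y) (r ^+ 2 * t).
Proof.
move=> c0 r0; have r20 : r ^+ 2 != 0 by rewrite expf_neq0.
by case: (derive_scale (fun s : R => u (r *: y) s) t (1 : R) c0 r20).
Qed.

Lemma inQ_rescale r T y t : 0 < r ->
  inQ 1 (T / r ^+ 2) y t -> inQ r T (r *: y) (r ^+ 2 * t).
Proof.
move=> r0 [y1 /andP[t0 tT]]; split; first by rewrite enormZ ?ltW// gtr_pMr.
by rewrite mulr_gt0 ?exprn_gt0//= mulrC -ltr_pdivlMr ?exprn_gt0.
Qed.

Lemma C21_rescale c r T u : 0 < c -> 0 < r -> C21 r T u ->
  C21 1 (T / r ^+ 2) (rescale c r u).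
Proof.
move=> c0 r0 cu y t /(inQ_rescale r0) /cu[[d1 [d2 d3]] k0 k1 k2 k3].
have c0' := lt0r_neq0 c0; have r0' := lt0r_neq0 r0.
have cr0 : c * r != 0 by rewrite mulf_neq0.
have r20 : r ^+ 2 != 0 by rewrite expf_neq0.
have cs (g : 'rV[R]_n -> R -> R) k :
    {for (r *: y, r ^+ 2 * t), continuous (fun z : 'rV[R]_n * R => g z.1 z.2)} ->
    {for (y, t), continuous (fun z : 'rV[R]_n * R => k * g (r *: z.1) (r ^+ 2 * z.2))}.
  move=> cg; apply: continuousM; first exact: cst_continuous.
  have f1 : r *: z.1 @[z --> (y, t)] --> r *: y.
    by apply: cvgZr; exact: cvg_fst.
  have f2 : r ^+ 2 * z.2 @[z --> (y, t)] --> r ^+ 2 * t.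
    by apply: cvgMr; exact: cvg_snd.
  exact: (@continuous2_cvg _ _ _ _ (nbhs (y, t)) _ (fun z => r *: z.1)
    (fun z => r ^+ 2 * z.2) g (r *: y) (r ^+ 2 * t) cg f1 f2).
split.
- split=> [i|]; first exact: (derive_scale (fun z => u z (r ^+ 2 * t)) y (ebasis R i) c0' r0').1 (d1 i).
  split; last exact: (derive_scale (fun s : R => u (r *: y) s) t (1 : R) c0' r20).1 d3.
  move=> i j.
  have -> : (fun z => dx (rescale c r u) i z t)
      = (fun z => c * r * dx u i (r *: z) (r ^+ 2 * t)).
    by apply/funext => z; rewrite dx_rescale.
  exact: (derive_scale (fun z => dx u i z (r ^+ 2 * t)) y (ebasis R j) cr0 r0').1 (d2 i j).
- exact: (@cs u c k0).
- move=> i.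
  have -> : (fun z : 'rV[R]_n * R => dx (rescale c r u) i z.1 z.2)
      = (fun z => c * r * dx u i (r *: z.1) (r ^+ 2 * z.2)).
    by apply/funext => z; rewrite dx_rescale.
  exact: (@cs (dx u i) _ (k1 i)).
- move=> i j.
  have -> : (fun z : 'rV[R]_n * R => dxx (rescale c r u) i j z.1 z.2)
      = (fun z => c * r * r * dxx u i j (r *: z.1) (r ^+ 2 * z.2)).
    by apply/funext => z; rewrite dxx_rescale.
  exact: (@cs (dxx u i j) _ (k2 i j)).
have -> : (fun z : 'rV[R]_n * R => dt (rescale c r u) z.1 z.2)
    = (fun z => c * r ^+ 2 * dt u (r *: z.1) (r ^+ 2 * z.2)).
  by apply/funext => z; rewrite dt_rescale.
exact: (@cs (dt u) _ k3).
Qed.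

Lemma enorm_grad_rescale c r u y t : 0 < c -> 0 < r ->
  enorm (grad (rescale c r u) y t) = c * r * enorm (grad u (r *: y) (r ^+ 2 * t)).
Proof.
move=> c0 r0; rewrite -enormZ; last by rewrite mulr_ge0// ltW.
by congr enorm; apply/rowP => i; rewrite !mxE dx_rescale// lt0r_neq0.
Qed.

(** With c r = r^beta, the left side of the equation scales by c r^2 = r^(beta + 1) and the right
    side by (c r)^p = r^(beta p); these agree because beta p = beta + 1. *)
Lemma solution_rescale p r T u : 1 < p -> 0 < r -> classical_solution p r T u ->
  classical_solution p 1 (T / r ^+ 2) (rescale (powR r (p - 1)^-1 / r) r u).
Proof.
move=> p1 r0 [cu sol]; set b := powR r (p - 1)^-1.
have b0 : 0 < b by rewrite powR_gt0.
have c0 : 0 < b / r by rewrite divr_gt0.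
have rn := lt0r_neq0 r0.
split; first exact: C21_rescale.
move=> y t yt; rewrite enorm_grad_rescale// divfK// powRM ?(ltW b0) ?enorm_ge0//.
have lapE : lap (rescale (b / r) r u) y t = b / r * r * r * lap u (r *: y) (r ^+ 2 * t).
  rewrite /lap [RHS]mulr_sumr; apply: eq_bigr => i _.
  exact: (dxx_rescale u i i y t (lt0r_neq0 c0) rn).
rewrite lapE -(sol _ _ (inQ_rescale r0 yt)) dt_rescale ?(lt0r_neq0 c0)//.
have -> : powR b p = b * r.
  rewrite -powRrM -[r in RHS]powRr1 ?ltW// -powRD ?rn ?implybT//.
  by congr powR; field; rewrite subr_eq0 gt_eqF.
by field.
Qed.

Lemma gradient_estimate (a p : R) : 0 <= a -> a < 1 -> 2 < p ->
  exists2 C : R, 0 < C & forall r T u x t, 0 < r -> classical_solution p r T u ->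
    enorm x < r / 2 -> 0 < t -> t < T ->
    a * powR (enorm (grad u x t)) p - dt u x t
      <= C * (powR r (- (p - 1)^-1 - 1) + powR r (1 - (p - 1)^-1) / t).
Proof.
(* The left side grows with a, so a may be raised to 1/2; the Bernstein argument wants a bounded
   away from 0. *)
move=> a0 a1 p2; pose a' := Num.max 2^-1 a.
have a'1 : a' < 1 by rewrite gt_max a1 andbT invf_lt1// ltr1n.
have a'2 : 2^-1 <= a' by rewrite le_max lexx.
have [C C0 HC] := @unit_estimate R n a' p a'2 a'1 p2.
have p1 : 1 < p by apply: lt_trans p2; rewrite ltr1n.
exists C => // r T u x t r0 sol xr t0 tT.
have rn := lt0r_neq0 r0.
set be := (p - 1)^-1; pose b := powR r be.
have b0 : 0 < b by rewrite powR_gt0.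
have bn := lt0r_neq0 b0.
have c0 : 0 < b / r by rewrite divr_gt0.
have r20 : 0 < r ^+ 2 by rewrite exprn_gt0.
have := HC _ _ (r^-1 *: x) (t / r ^+ 2) (solution_rescale p1 r0 sol).
rewrite enormZ ?invr_ge0 ?(ltW r0)// -/be -/b.
rewrite enorm_grad_rescale// dt_rescale ?(lt0r_neq0 c0)//.
have e1 : r *: (r^-1 *: x) = x by rewrite scalerA mulfV// scale1r.
have e2 : r ^+ 2 * (t / r ^+ 2) = t by rewrite mulrC divfK// lt0r_neq0.
rewrite e1 e2.
rewrite divfK// powRM ?(ltW b0) ?enorm_ge0//.
have -> : powR b p = b * r.
  rewrite -powRrM -[r in RHS]powRr1 ?ltW// -powRD ?rn ?implybT//.
  by congr powR; rewrite /be; field; rewrite subr_eq0 gt_eqF.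
have -> : powR r (- be - 1) = (b * r)^-1.
  rewrite -opprD powRN powRD ?rn ?implybT// powRr1 ?ltW//.
have -> : powR r (1 - be) = r / b.
  by rewrite powRD ?rn ?implybT// powRN powRr1// ltW.
set G := powR _ p.
have G0 : 0 <= G by exact: powR_ge0.
have xr1 : r^-1 * enorm x < 2^-1.
  by rewrite mulrC ltr_pdivrMr// mulrC.
have t1 : 0 < t / r ^+ 2 by rewrite divr_gt0.
have t2 : t / r ^+ 2 < T / r ^+ 2 by rewrite ltr_pM2r// invr_gt0.
move=> /(_ xr1 t1 t2) H.
have aG : a * G - dt u x t <= a' * G - dt u x t.
  by rewrite lerB// ler_wpM2r// le_max lexx orbT.
apply: (le_trans aG).
have br0 : 0 < b * r by rewrite mulr_gt0.
(* The rescaling multiplies both |grad u|^p and u_t by b r = r^(beta + 1). *)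
rewrite -(ler_pM2l br0).
have -> : b * r * (a' * G - dt u x t) = a' * (b * r * G) - b / r * r ^+ 2 * dt u x t.
  by field.
apply: (le_trans H); rewrite le_eqVlt; apply/orP; left; apply/eqP; field.
by rewrite bn rn lt0r_neq0.
Qed.

End rescaling.

(** * The Harnack inequality *)

Section harnack.
Set Implicit Arguments. Unset Strict Implicit. Unset Printing Implicit Defensive.
Local Open Scope classical_set_scope.
Local Open Scope ring_scope.
Context {R : realType} {n : nat}.
Implicit Types (x y z d : 'rV[R]_n) (t s r T : R) (u : 'rV[R]_n -> R -> R).

Lemma mean_value_signed (f df : R -> R) (b : R) :
  (forall s : R, `|s| <= `|b| -> is_derive s 1 f (df s)) ->
  exists2 c, `|c| <= `|b| & f b - f 0 = df c * b.
Proof.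
move=> fdf; have [b0|b0|->] := ltgtP b 0; last first.
- by exists 0; rewrite ?normr0// !subrr mulr0.
- have [s /andP[bs sb]|c /andP[c0 cb] E] := @mean_value R f df 0 b b0.
    by apply: fdf; rewrite !ger0_norm// ltW.
  by exists c; [rewrite !gtr0_norm// ltW|rewrite E subr0].
have [s /andP[bs sb]|c /andP[c0 cb] E] := @mean_value R f df b 0 b0.
  by apply: fdf; rewrite !ler0_norm ?lerN2// ltW.
exists c; first by rewrite !ltr0_norm// lerN2 ltW.
by rewrite -opprB E sub0r mulrN opprK.
Qed.

(** Telescoping along the axes: [c k] keeps the first k coordinates of b, and each step is a
    one-variable mean value on the box spanned by b. *)
Lemma increment_approx (g : 'rV[R]_n -> R) (z b : 'rV[R]_n) (G : 'I_n -> R) (e : R) :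
  (forall y, (forall j, `|y ord0 j - z ord0 j| <= `|b ord0 j|) -> forall i,
    derivable g y (ebasis R i) /\ `|'D_(ebasis R i) g y - G i| <= e) ->
  `|g (z + b) - g z - \sum_(i < n) G i * b ord0 i| <= e * \sum_(i < n) `|b ord0 i|.
Proof.
move=> H; pose c k : 'rV[R]_n := \row_i (if (i < k)%N then b ord0 i else 0).
suff step k : (k <= n)%N ->
    `|g (z + c k) - g z - \sum_(i < n | (i < k)%N) G i * b ord0 i|
      <= e * \sum_(i < n | (i < k)%N) `|b ord0 i|.
  have := step n (leqnn n); have -> : c n = b.
    by apply/rowP => i; rewrite mxE ltn_ord.
  have S (f : 'I_n -> R) : \sum_(i < n | (i < n)%N) f i = \sum_(i < n) f i.
    by apply: eq_bigl => i; rewrite ltn_ord.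
  by rewrite !S.
elim: k => [_|k IH kn].
  rewrite !big_pred0 // mulr0 subr0; have -> : c 0%N = 0 by apply/rowP => i; rewrite !mxE.
  by rewrite addr0 subrr normr0.
pose i0 := Ordinal kn.
have S (f : 'I_n -> R) : \sum_(i < n | (i < k.+1)%N) f i
    = \sum_(i < n | (i < k)%N) f i + f i0.
  rewrite (bigD1 i0) /= ?ltnSn// addrC; congr (_ + _); apply: eq_bigl => i.
  by rewrite ltnS leq_eqVlt -val_eqE/=; case: ltngtP.
have cS : c k.+1 = c k + b ord0 i0 *: ebasis R i0.
  apply/rowP => i; rewrite !mxE !eqxx/= ltnS leq_eqVlt -(val_eqE i i0)/=.
  have [ik|ik|ik] := ltngtP (val i) k; rewrite ?mulr0 ?addr0//.
  by rewrite mulr1 add0r; congr (b _ _); apply: val_inj.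
have [s sb|c' cb E] := @mean_value_signed
    (fun s => g (z + c k + s *: ebasis R i0))
    (fun s => 'D_(ebasis R i0) g (z + c k + s *: ebasis R i0)) (b ord0 i0).
  apply: is_derive_line; have [] // := H (z + c k + s *: ebasis R i0) _ i0.
  move=> j; rewrite !mxE !eqxx/= addrAC -addrA addrC addrK.
  have [jk|jk|jk] := ltngtP (val j) k.
  + by rewrite -val_eqE/= (ltn_eqF jk) mulr0 add0r.
  + by rewrite -val_eqE/= (gtn_eqF jk) mulr0 add0r normr0.
  + by have -> : j = i0 by [apply: val_inj]; rewrite eqxx mulr1 addr0.
have [_ Hc] : derivable g (z + c k + c' *: ebasis R i0) (ebasis R i0) /\
    `|'D_(ebasis R i0) g (z + c k + c' *: ebasis R i0) - G i0| <= e.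
  apply: H => j; rewrite !mxE !eqxx/= addrAC -addrA addrC addrK.
  have [jk|jk|jk] := ltngtP (val j) k.
  + by rewrite -val_eqE/= (ltn_eqF jk) mulr0 add0r.
  + by rewrite -val_eqE/= (gtn_eqF jk) mulr0 add0r normr0.
  + by have -> : j = i0 by [apply: val_inj]; rewrite eqxx mulr1 addr0.
rewrite !S cS addrA; move: E; rewrite scale0r addr0 => E.
set w := 'D_ _ _ _ in E Hc.
have -> : g (z + c k + b ord0 i0 *: ebasis R i0) - g z
      - (\sum_(i < n | (i < k)%N) G i * b ord0 i + G i0 * b ord0 i0)
    = (g (z + c k) - g z - \sum_(i < n | (i < k)%N) G i * b ord0 i)
      + (w - G i0) * b ord0 i0.
  by rewrite mulrBl -E; ring.
apply: (le_trans (ler_normD _ _)); rewrite mulrDr lerD ?IH ?(ltnW kn)//.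
by rewrite normrM ler_wpM2r.
Qed.

Lemma inQ_near r T x t : 0 < r -> inQ r T x t ->
  \forall z \near (x, t), inQ r T z.1 z.2.
Proof.
move=> r0 [xr /andP[t0 tT]].
have cn : {for (x, t), continuous (fun z : 'rV[R]_n * R => sqnorm z.1)}.
  apply: (@continuous_comp _ _ _ fst (@sqnorm R n)); first exact: cvg_fst.
  exact: sqnorm_continuous.
have ct : {for (x, t), continuous (fun z : 'rV[R]_n * R => z.2)} by exact: cvg_snd.
have n1 : \forall z \near (x, t), sqnorm z.1 < r ^+ 2.
  by apply: (cvgr_lt (sqnorm x) cn); rewrite -enorm_lt.
have n2 : \forall z \near (x, t), 0 < z.2 by apply: (cvgr_gt t ct).
have n3 : \forall z \near (x, t), z.2 < T by apply: (cvgr_lt t ct).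
apply: filterS3 n1 n2 n3 => z z1 z2 z3.
by split; [rewrite enorm_lt|rewrite z2].
Qed.

(** [C21] provides partial derivatives and their continuity, not joint differentiability. The
    increment is therefore split into a space increment at time tau and a time increment at the
    shifted point. *)
Lemma is_derive_segment r T u x d t L s : 0 < r -> C21 r T u ->
  inQ r T (x + s *: d) (t + s * L) ->
  is_derive s 1 (fun s => u (x + s *: d) (t + s * L))
    (\sum_(i < n) dx u i (x + s *: d) (t + s * L) * d ord0 i
     + dt u (x + s *: d) (t + s * L) * L).
Proof.
move=> r0 cu; set z := x + s *: d; set tau := t + s * L => zQ.
have [_ _ c1 _ c2] := cu _ _ zQ.
set A := \sum_(i < n) _ + _.
(* The summand 1 makes M positive even when d and L vanish; it reappears as the spare e' |h| at the
   end. *)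
pose M := \sum_(i < n) `|d ord0 i| + `|L| + 1.
have sd0 : 0 <= \sum_(i < n) `|d ord0 i| by apply: sumr_ge0.
have M0 : 0 < M by rewrite ltr_wpDl// addr_ge0.
have cv : h^-1 *: (u (x + (h *: 1 + s) *: d) (t + (h *: 1 + s) * L) - u z tau)
    @[h --> (0 : R)^'] --> A.
  apply/cvgrPdist_le => e e0.
  pose e' := e / M; have e'0 : 0 < e' by rewrite divr_gt0.
  have nd : \forall w \near (z, tau), forall i, `|dx u i w.1 w.2 - dx u i z tau| <= e'.
    apply: (@filter_forall _ _ (fun i (w : 'rV[R]_n * R) => `|dx u i w.1 w.2 - dx u i z tau| <= e') (nbhs (z, tau))) => i; have /cvgrPdist_le/(_ e' e'0) ci := c1 i.
    by apply: filterS ci => w /=; rewrite distrC.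
  have nt : \forall w \near (z, tau), `|dt u w.1 w.2 - dt u z tau| <= e'.
    have /cvgrPdist_le/(_ e' e'0) ct := c2.
    by apply: filterS ct => w /=; rewrite distrC.
  have nall : \forall w \near (z, tau), ((forall i, `|dx u i w.1 w.2 - dx u i z tau| <= e') /\
      `|dt u w.1 w.2 - dt u z tau| <= e') /\ inQ r T w.1 w.2.
    exact: (filterI (filterI nd nt) (inQ_near r0 zQ)).
  move: nall => /nbhs_ballP[k /= k0 Hk].
  have {}Hk (w : 'rV[R]_n) (w' : R) : (forall j, `|w ord0 j - z ord0 j| < k) ->
      `|w' - tau| < k -> [/\ forall i, `|dx u i w w' - dx u i z tau| <= e',
        `|dt u w w' - dt u z tau| <= e' & inQ r T w w'].
    move=> wz wt; have /Hk[[]] // : ball (z, tau) k (w, w').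
    split=> /=; last by rewrite /ball/= distrC.
    by split=> // i j; rewrite ord1 /ball/= distrC.
  near=> h.
  have h0 : h != 0 by near: h; exact: nbhs_dnbhs_neq.
  have hk : `|h| * M < k.
    rewrite -ltr_pdivlMr//; near: h; apply: dnbhs0_lt; exact: divr_gt0.
  have hd j : `|h * d ord0 j| < k.
    apply: le_lt_trans hk; rewrite normrM ler_wpM2l//.
    rewrite /M (bigD1 j)//= -!addrA lerDl !addr_ge0//.
    by apply: sumr_ge0.
  have hL : `|h * L| < k.
    apply: le_lt_trans hk; rewrite normrM ler_wpM2l// /M.
    by rewrite [X in X + 1]addrC -addrA lerDl addr_ge0.
  have k00 : `|tau - tau| < k by rewrite subrr normr0.
  have -> : x + (h *: 1 + s) *: d = z + h *: d.
    by rewrite [h *: 1]mulr1 scalerDl addrCA addrC.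
  have -> : t + (h *: 1 + s) * L = tau + h * L.
    by rewrite [h *: 1]mulr1 /tau; ring.
  have S1 : `|u (z + h *: d) tau - u z tau
      - \sum_(i < n) dx u i z tau * (h *: d) ord0 i|
      <= e' * \sum_(i < n) `|(h *: d) ord0 i|.
    apply: (increment_approx (g := fun y => u y tau)) => y yz i.
    have yk j : `|y ord0 j - z ord0 j| < k.
      by apply: le_lt_trans (yz j) _; rewrite mxE.
    have [H1 _ /cu[[du _] _ _ _ _]] := Hk y tau yk k00.
    by split; [exact: du|exact: H1].
  have zk j : `|(z + h *: d) ord0 j - z ord0 j| < k.
    by rewrite !mxE addrAC subrr add0r.
  have [s' sL|c cL E] := @mean_value_signed (fun s' => u (z + h *: d) (tau + s'))
     (fun s' => dt u (z + h *: d) (tau + s')) (h * L).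
    have sk : `|tau + s' - tau| < k by rewrite addrC addKr; apply: le_lt_trans hL.
    have [_ _ H3] := Hk _ _ zk sk.
    have D1 := is_derive_dt cu H3.
    have D2 := is_derive1D (is_derive_cst tau s' 1) (is_derive_id s' 1).
    have D3 := is_derive1_compose (f := u (z + h *: d)) (g := fun s => tau + s) D1 D2.
    by apply: (is_derive_eq D3); rewrite add0r mulr1.
  have ck : `|tau + c - tau| < k by rewrite addrC addKr; apply: le_lt_trans hL.
  have [_ H2 _] := Hk _ _ zk ck.
  move: E; rewrite addr0 => E.
  have S2 : `|u (z + h *: d) (tau + h * L) - u (z + h *: d) tau - dt u z tau * (h * L)|
      <= e' * `|h * L| by rewrite E -mulrBl normrM ler_wpM2r.
  have AE : h * A = \sum_(i < n) dx u i z tau * (h *: d) ord0 i + dt u z tau * (h * L).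
    rewrite /A mulrDr mulr_sumr; congr (_ + _); last by ring.
    by apply: eq_bigr => i _; rewrite mxE; ring.
  have h0' : 0 < `|h| by rewrite normr_gt0.
  rewrite -(ler_pM2l h0') -normrM mulrBr [h^-1 *: _]/(h^-1 * _) mulrA mulfV// mul1r.
  rewrite AE distrC.
  have -> : `|h| * e = e' * \sum_(i < n) `|(h *: d) ord0 i| + e' * `|h * L| + e' * `|h|.
    have -> : \sum_(i < n) `|(h *: d) ord0 i| = `|h| * \sum_(i < n) `|d ord0 i|.
      by rewrite mulr_sumr; apply: eq_bigr => i _; rewrite mxE normrM.
    have eE : e = e' * M by rewrite /e' divfK// lt0r_neq0.
    by rewrite [in LHS]eE /M normrM; ring.
  have -> : u (z + h *: d) (tau + h * L) - u z tau -
      (\sum_(i < n) dx u i z tau * (h *: d) ord0 i + dt u z tau * (h * L)) =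
      (u (z + h *: d) tau - u z tau - \sum_(i < n) dx u i z tau * (h *: d) ord0 i)
      + (u (z + h *: d) (tau + h * L) - u (z + h *: d) tau - dt u z tau * (h * L)) by ring.
  apply: (le_trans (ler_normD _ _)); apply: (@le_trans _ _ _ _ _ (lerD S1 S2)).
  by rewrite lerDl mulr_ge0// ltW.
by apply: DeriveDef; [apply/cvg_ex; exists A; exact: cv|exact: (cvg_lim _ cv)].
Unshelve. all: by end_near. Qed.

Lemma enorm_cauchy x y :
  `|\sum_(i < n) x ord0 i * y ord0 i| <= enorm x * enorm y.
Proof.
have expand (k l : R) : \sum_(i < n) (k * x ord0 i - l * y ord0 i) ^+ 2
    = k ^+ 2 * sqnorm x - 2 * k * l * (\sum_(i < n) x ord0 i * y ord0 i)
      + l ^+ 2 * sqnorm y.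
  rewrite /sqnorm !mulr_sumr -sumrB -big_split/=.
  by apply: eq_bigr => i _; ring.
set c := \sum_(i < n) x ord0 i * _ in expand *.
(* Expands |k x - l y|^2 >= 0 at k = |y|^2 and l = x.y; the factor |y|^2 is then cancelled unless it
   is zero. *)
have H : sqnorm y * c ^+ 2 <= sqnorm y * (sqnorm x * sqnorm y).
  have : 0 <= \sum_(i < n) (sqnorm y * x ord0 i - c * y ord0 i) ^+ 2.
    by apply: sumr_ge0 => i _; rewrite sqr_ge0.
  by rewrite expand; clear; lra.
rewrite -(@ler_sqr _ `|c|) ?nnegrE ?mulr_ge0 ?enorm_ge0//.
rewrite real_normK ?num_real// exprMn !enorm_sqr.
have [y0|y0] := eqVneq (sqnorm y) 0; last first.
  by rewrite -(ler_pM2l (_ : 0 < sqnorm y)) // lt_neqAle eq_sym y0 sqnorm_ge0.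
have c0 : c = 0.
  rewrite /c big1// => i _.
  have : y ord0 i ^+ 2 <= 0.
    rewrite -y0 /sqnorm (bigD1 i)//= lerDl.
    by apply: sumr_ge0 => j _; rewrite sqr_ge0.
  move=> yi; have : y ord0 i ^+ 2 == 0 by rewrite eq_le yi sqr_ge0.
  by rewrite expf_eq0/= => /eqP ->; rewrite mulr0.
by rewrite c0 expr0n y0 mulr0.
Qed.

Lemma sqnorm_convex x y s : 0 <= s -> s <= 1 ->
  sqnorm (x + s *: (y - x)) <= (1 - s) * sqnorm x + s * sqnorm y.
Proof.
move=> s0 s1; rewrite /sqnorm !mulr_sumr -big_split/=; apply: ler_sum => i _.
rewrite !mxE; move: (x _ _) (y _ _) => a b.
have := mulr_ge0 (mulr_ge0 s0 (_ : 0 <= 1 - s)) (sqr_ge0 (a - b)).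
by rewrite subr_ge0 => /(_ s1); lra.
Qed.

(** Either 2 d <= L g^(p-1), and the first term suffices, or g < (2 d / L)^beta, and then g d is at
    most the second term because p beta = beta + 1. The coefficient 1/2 matches the use of the
    gradient estimate with a = 1/2. *)
Lemma young_powR (p g d L : R) : 1 < p -> 0 <= g -> 0 <= d -> 0 < L ->
  g * d <= L * (2^-1 * powR g p)
    + powR 2 (p - 1)^-1 * powR (powR d p / L) (p - 1)^-1.
Proof.
move=> p1 g0 d0 L0; set be := (p - 1)^-1.
have p10 : 0 < p - 1 by rewrite subr_gt0.
have be0 : 0 < be by rewrite invr_gt0.
have p0 : 0 < p by apply: lt_trans p1.
have E1 : g * powR g (p - 1) = powR g p by exact: mulr_powRB1.
have t1 : 0 <= powR 2 be * powR (powR d p / L) be by rewrite mulr_ge0 ?powR_ge0.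
have t2 : 0 <= L * (2^-1 * powR g p) by rewrite !mulr_ge0 ?powR_ge0// ?invr_ge0// ltW.
have [h|h] := leP (2 * d) (L * powR g (p - 1)).
  have : g * (2 * d) <= g * (L * powR g (p - 1)) by rewrite ler_wpM2l.
  by rewrite mulrCA [g * (L * _)]mulrCA E1; lra.
have gb : g <= powR (2 * d / L) be.
  have -> : g = powR (powR g (p - 1)) be.
    by rewrite -powRrM /be mulfV ?lt0r_neq0// powRr1.
  have dL : 0 <= 2 * d / L by rewrite divr_ge0 ?mulr_ge0// ltW.
  apply: ge0_ler_powR; rewrite ?nnegrE ?powR_ge0 ?(ltW be0)//.
  by rewrite ler_pdivlMr// mulrC ltW.
apply: (@le_trans _ _ (powR (2 * d / L) be * d)); first by rewrite ler_wpM2r.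
have L1 : 0 <= L^-1 by rewrite invr_ge0 ltW.
have E2 : powR (powR d p / L) be = powR d be * d * powR L^-1 be.
  rewrite powRM ?powR_ge0// -powRrM; congr (_ * _).
  have -> : p * be = be + 1 by rewrite /be; field; rewrite lt0r_neq0.
  by rewrite powRD ?powRr1// (gt_eqF (ltr_wpDl (ltW be0) ltr01)).
have -> : powR (2 * d / L) be * d = powR 2 be * powR (powR d p / L) be.
  rewrite E2 powRM ?mulr_ge0// powRM//; ring.
by rewrite lerDr.
Qed.

(** The mean value theorem stands for the integral: one point of the segment, at a time tau >= t,
    carries the whole increment, and the gradient estimate is applied there with 1/tau <= 1/t. *)
Lemma harnack_estimate (p : R) : 2 < p ->
  exists2 C : R, 0 < C & forall r T u, 0 < r -> classical_solution p r T u ->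
    forall t s x y, 0 < t -> t < s -> s < T -> enorm x < r / 2 -> enorm y < r / 2 ->
      u x t <= u y s + C * powR (powR (enorm (y - x)) p / (s - t)) (p - 1)^-1
        + C * (powR r (- (p - 1)^-1 - 1) + powR r (1 - (p - 1)^-1) / t) * (s - t).
Proof.
move=> p2; set be := (p - 1)^-1.
have p1 : 1 < p by apply: lt_trans p2; rewrite ltr1n.
have h0 : 0 <= 2^-1 :> R by rewrite invr_ge0.
have h1 : 2^-1 < 1 :> R by rewrite invf_lt1// ltr1n.
have [C C0 HC] := @gradient_estimate R n 2^-1 p h0 h1 p2.
(* 2^beta is the factor from [young_powR] and C that of the gradient estimate; their sum serves both
   terms, the surplus being nonnegative. *)
exists (C + powR 2 be); first by rewrite addr_gt0// powR_gt0.
move=> r T u r0 sol t s x y t0 ts sT xr yr.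
have cu : C21 r T u by case: sol.
pose L := s - t; have L0 : 0 < L by rewrite subr_gt0.
pose d := y - x.
have r20 : 0 < r / 2 by rewrite divr_gt0.
have inB c : 0 <= c -> c <= 1 -> enorm (x + c *: d) < r / 2.
  move=> c0 c1; rewrite enorm_lt//; apply: (le_lt_trans (sqnorm_convex x y c0 c1)).
  move: xr yr; rewrite !enorm_lt//; move: (sqnorm x) (sqnorm y) ((r / 2) ^+ 2).
  move=> z1 z2 z3 z13 z23; have zm : Num.max z1 z2 < z3 by rewrite gt_max z13.
  apply: le_lt_trans zm; have c10 : 0 <= 1 - c by rewrite subr_ge0.
  have m1 : (1 - c) * z1 <= (1 - c) * Num.max z1 z2 by rewrite ler_wpM2l// le_max lexx.
  have m2 : c * z2 <= c * Num.max z1 z2 by rewrite ler_wpM2l// le_max lexx orbT.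
  by move: m1 m2; clear; lra.
have inT c : 0 <= c -> c <= 1 -> t <= t + c * L < T.
  move=> c0 c1; rewrite lerDl mulr_ge0 ?(ltW L0)//=.
  apply: le_lt_trans sT; rewrite -[leRHS](subrK t) addrC lerD2r.
  by rewrite -/L ler_piMl// ltW.
have inQ_c c : 0 <= c -> c <= 1 -> inQ r T (x + c *: d) (t + c * L).
  move=> c0 c1; split.
    by apply: (lt_trans (inB c c0 c1)); rewrite ltr_pdivrMr// mulr_natr mulr2n ltrDl.
  by have /andP[tc ->] := inT c c0 c1; rewrite (lt_le_trans t0 tc).
have [c c01|c /andP[c0 c1]] := @mean_value R (fun c => u (x + c *: d) (t + c * L))
    (fun c => \sum_(i < n) dx u i (x + c *: d) (t + c * L) * d ord0 i
     + dt u (x + c *: d) (t + c * L) * L) 0 1 ltr01.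
  by case/andP: c01 => c0 c1; apply: (is_derive_segment r0 cu); exact: inQ_c.
rewrite scale1r scale0r addr0 mul1r mul0r addr0 subr0 mulr1.
have -> : x + d = y by rewrite /d addrC subrK.
have -> : t + L = s by rewrite /L addrC subrK.
have {}c0 := ltW c0; have {}c1 := ltW c1.
set z := x + c *: d; set tau := t + c * L => E.
have /andP[ttau tauT] := inT c c0 c1.
have tau0 : 0 < tau by apply: lt_le_trans ttau.
have HCz := HC r T u z tau r0 sol (inB c c0 c1) tau0 tauT.
set b1 := powR r (- be - 1) in HCz *; set b2 := powR r (1 - be) in HCz *.
set g := enorm (grad u z tau) in HCz *.
have b20 : 0 <= b2 by exact: powR_ge0.
have b10 : 0 <= b1 by exact: powR_ge0.
have bt : C * (b1 + b2 / tau) <= C * (b1 + b2 / t).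
  by rewrite ler_pM2l// lerD2l ler_wpM2l// lef_pV2.
have Y := young_powR p1 (enorm_ge0 (grad u z tau)) (enorm_ge0 d) L0.
have CS : - (g * enorm d) <= \sum_(i < n) dx u i z tau * d ord0 i.
  have := enorm_cauchy (grad u z tau) d; rewrite -/g => CS.
  have -> : \sum_(i < n) dx u i z tau * d ord0 i
      = \sum_(i < n) (grad u z tau) ord0 i * d ord0 i.
    by apply: eq_bigr => i _; congr (_ * _); rewrite mxE.
  by move: CS; rewrite ler_norml => /andP[].
have HL : L * (2^-1 * powR g p) - dt u z tau * L <= C * (b1 + b2 / t) * L.
  rewrite mulrC -mulrBl ler_pM2r//; exact: (le_trans HCz).
rewrite -/be -/g in Y; rewrite -/L -/d.
set q := powR (_ / L) be in Y *.
have q0 : 0 <= q by exact: powR_ge0.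
have k0 : 0 <= powR 2 be * ((b1 + b2 / t) * L).
  apply: mulr_ge0; first exact: powR_ge0.
  by rewrite mulr_ge0 ?(ltW L0)// addr_ge0// divr_ge0// ltW.
have k1 : 0 <= C * q by rewrite mulr_ge0// ltW.
move: E CS Y HL k0 k1; clear; lra.
Qed.

End harnack.

Theorem theorem2p7 (R : realType) (n : nat) (p : R) (hp : 2 < p) :
  let beta := (p - 1)^-1 in
  (forall a : R, 0 <= a < 1 ->
     exists C : R, 0 < C /\
       forall (r T : R) (u : 'rV[R]_n -> R -> R),
         0 < r -> 0 < T -> classical_solution p r T u ->
         forall (x : 'rV[R]_n) (t : R), enorm x < r / 2 -> 0 < t < T ->
           a * powR (enorm (grad u x t)) p - dt u x t
             <= C * (powR r (- beta - 1) + powR r (1 - beta) / t))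
  /\
  (exists C : R, 0 < C /\
     forall (r T : R) (u : 'rV[R]_n -> R -> R),
       0 < r -> 0 < T -> classical_solution p r T u ->
       forall (t s : R) (x y : 'rV[R]_n), 0 < t -> t < s -> s < T ->
         enorm x < r / 2 -> enorm y < r / 2 ->
         u x t <= u y s + C * powR (powR (enorm (y - x)) p / (s - t)) beta
                   + C * (powR r (- beta - 1) + powR r (1 - beta) / t) * (s - t)).
Proof.
split.
- move=> a /andP[a0 a1].
  have [C C0 HC] := @gradient_estimate R n a p a0 a1 hp.
  by exists C; split=> // r T u r0 _ sol x t xr /andP[t0 tT]; exact: (HC r T).
have [C C0 HC] := @harnack_estimate R n p hp.
by exists C; split=> // r T u r0 _ sol; exact: (HC r T).
Qed.
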